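(* Let $X$ be a compact metric space, $f:X\to X$ a homeomorphism, $\tau:X\to(0,+\infty)$ a continuous function, and $\phi^{\tau,f}$ the suspension flow over $f$ with height function $\tau$, on the space $X^{\tau,f}$. Then $$Sh(\phi^{\tau,f})=\{(x,t): x\in Sh(f),\ 0\le t\le\tau(x)\}/\sim,$$ that is, under the identification of $X^{1,f}$ with $X^{\tau,f}$ given by $(x,t)\mapsto(x,t\tau(x))$, $Sh(\phi^{\tau,f})=(Sh(f)\times[0,1])/\sim$.
   Context: Suspensions. $X^{\tau,f}=\{(x,t):0\le t\le\tau(x),\ x\in X\}/\sim$, where $(x,\tau(x))\sim(f(x),0)$ for all $x\in X$. The suspension flow $\phi^{\tau,f}$ is the flow on $X^{\tau,f}$ determined by $\phi^{\tau,f}_t(x,s)=(x,s+t)$ whenever $s+t\in[0,\tau(x)]$. $X^{1,f}$ is the case $\tau\equiv1$; the map $(x,t)\mapsto(x,t\tau(x))$ is a homeomorphism $X^{1,f}\to X^{\tau,f}$. The space $X^{\tau,f}$ is a compact metric space with the Bowen–Walters metric $d^{\tau,f}$: one replaces the metric $d$ of $X$ by an equivalent one if necessary so that $\mathrm{diam}(X)=1$; for $\tau\equiv1$, a horizontal segment from $(x,t)$ to $(y,t)$ has length $(1-t)d(x,y)+t\,d(f(x),f(y))$, a vertical segment between two points on the same orbit has length the shortest time distance between them along the orbit, and $d^{1,f}$ of two points is the infimum of the total lengths of finite paths of horizontal and vertical segments joining them; in general $d^{\tau,f}((x,t),(y,s))=d^{1,f}((x,t/\tau(x)),(y,s/\tau(y)))$.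 Shadowable points of a homeomorphism. For $\delta>0$, a $\delta$-pseudo-orbit of $f$ passing through $p$ is a sequence $(x_n)_{n\in\mathbb{Z}}$ with $x_0=p$ and $d(f(x_n),x_{n+1})\le\delta$ for all $n\in\mathbb{Z}$. The point $p$ is shadowable if for each $\varepsilon>0$ there is $\delta>0$ such that for every $\delta$-pseudo-orbit $(x_n)_{n\in\mathbb{Z}}$ passing through $p$ there is $q\in X$ with $d(f^n(q),x_n)\le\varepsilon$ for all $n\in\mathbb{Z}$. $Sh(f)$ is the set of shadowable points of $f$. Shadowable points of a flow. Let $\phi=(\phi_t)_{t\in\mathbb{R}}$ be a continuous flow on a compact metric space with metric $\rho$. Given $\delta,T>0$, a $(\delta,T)$-pseudo-orbit is a sequence $(x_i,t_i)_{i\in\mathbb{Z}}$ with $t_i\ge T$ and $\rho(\phi_{t_i}(x_i),x_{i+1})\le\delta$ for all $i\in\mathbb{Z}$; it passes through $p$ if $x_0=p$. Put $s_0=0$, $s_i=\sum_{j=0}^{i-1}t_j$ for $i>0$, $s_i=-\sum_{j=i}^{-1}t_j$ for $i<0$, and $x_0\star t=\phi_{t-s_i}(x_i)$ whenever $s_i\le t<s_{i+1}$. $\mathrm{Rep}$ is the set of surjective strictly increasing maps $h:\mathbb{R}\to\mathbb{R}$ with $h(0)=0$. The pseudo-orbit is $\varepsilon$-shadowed if there are a point $y$ and $h\in\mathrm{Rep}$ with $\rho(x_0\star t,\phi_{h(t)}(y))\le\varepsilon$ for all $t\in\mathbb{R}$. A point $p$ is shadowable if for every $\varepsilon>0$ there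 is $\delta>0$ such that every $(\delta,1)$-pseudo-orbit passing through $p$ is $\varepsilon$-shadowed; $Sh(\phi)$ is the set of shadowable points of $\phi$. *)

(* Defs.v *)
From HB Require Import structures.
From Stdlib Require Import Relation_Operators.
From mathcomp Require Import all_boot all_order all_algebra.
From mathcomp Require Import generic_quotient.
From mathcomp Require Import all_classical all_reals all_analysis.
From mathcomp Require Import lra.

Set Implicit Arguments.
Unset Strict Implicit.
Unset Printing Implicit Defensive.

Import Order.TTheory GRing.Theory Num.Theory.
Import numFieldNormedType.Exports.

Local Open Scope classical_set_scope.
Local Open Scope ring_scope.
Local Open Scope quotient_scope.

Record homeomorphism (X : topologicalType) := Homeomorphism {
  homeo_fun :> X -> X ;
  homeo_inv : X -> X ;
  homeoK : cancel homeo_fun homeo_inv ;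
  homeoVK : cancel homeo_inv homeo_fun ;
  homeo_continuous : continuous homeo_fun ;
  homeo_inv_continuous : continuous homeo_inv }.

(* f^n for n : int; recall that Negz m is - (m + 1) *)
Definition iterz (X : topologicalType) (f : homeomorphism X) (n : int) : X -> X :=
  match n with
  | Posz m => iter m f
  | Negz m => iter m.+1 (homeo_inv f)
  end.

(* s_0 = 0, s_i = \sum_(0 <= j < i) t_j for i > 0,
   s_i = - \sum_(i <= j < 0) t_j for i < 0 *)
Definition psumz (R : zmodType) (t : int -> R) (i : int) : R :=
  match i with
  | Posz m => \sum_(j < m) t (Posz j)
  | Negz m => - \sum_(j < m.+1) t (Negz j)
  end.

Section shadowable_homeomorphism.
Context {R : realType} {X : metricType R} (f : homeomorphism X).

Definition pseudo_orbit (delta : R) (x : int -> X) :=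
  forall n : int, mdist (f (x n)) (x (n + 1)) <= delta.

Definition shadowable_points : set X := [set p |
  forall eps : R, 0 < eps -> exists2 delta : R, 0 < delta &
    forall x : int -> X, pseudo_orbit delta x -> x 0 = p ->
      exists q, forall n : int, mdist (iterz f n q) (x n) <= eps].

End shadowable_homeomorphism.

Section shadowable_flow.
Context {R : realType} {Y : Type} (rho : Y -> Y -> R) (phi : R -> Y -> Y).

Definition flow_pseudo_orbit (delta T : R) (x : int -> Y) (t : int -> R) :=
  forall i : int, T <= t i /\ rho (phi (t i) (x i)) (x (i + 1)) <= delta.

(* x_0 * u; the index i is unique as soon as the t_i are bounded below by some
   T > 0: see psumz_cover and starE *)
Definition star (x : int -> Y) (t : int -> R) (u : R) : Y :=
  let i := xget 0 [set i | psumz t i <= u < psumz t (i + 1)] in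
  phi (u - psumz t i) (x i).

Definition reparametrization (h : R -> R) :=
  [/\ h 0 = 0, {homo h : u v / u < v} & forall v, exists u, h u = v].

Definition flow_shadowed (eps : R) (x : int -> Y) (t : int -> R) :=
  exists (y : Y) (h : R -> R), reparametrization h /\
    forall u : R, rho (star x t u) (phi (h u) y) <= eps.

Definition flow_shadowable_points : set Y := [set p |
  forall eps : R, 0 < eps -> exists2 delta : R, 0 < delta &
    forall (x : int -> Y) (t : int -> R), flow_pseudo_orbit delta 1 x t ->
      x 0 = p -> flow_shadowed eps x t].

End shadowable_flow.

Section suspension.
Context {R : realType} {X : metricType R} (f : homeomorphism X) (tau : X -> R).

Definition presuspension := {p : X * R | 0 <= p.2 <= tau p.1}.

Definition glue (u v : presuspension) :=
  (val u).2 = tau (val u).1 /\ val v = (f (val u).1, 0).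

Definition suspension_rel : rel presuspension :=
  fun u v => `[< clos_refl_sym_trans _ glue u v >].

Lemma suspension_rel_refl : reflexive suspension_rel.
Proof. by move=> u; apply/asboolP; exact: rst_refl. Qed.

Lemma suspension_rel_sym : symmetric suspension_rel.
Proof. by move=> u v; apply/asboolP/asboolP; exact: rst_sym. Qed.

Lemma suspension_rel_trans : transitive suspension_rel.
Proof.
by move=> v u w /asboolP uv /asboolP vw; apply/asboolP; exact: rst_trans vw.
Qed.

Canonical suspension_equiv :=
  EquivRel suspension_rel suspension_rel_refl suspension_rel_sym
    suspension_rel_trans.

Definition suspension : Type := {eq_quot suspension_rel}.
HB.instance Definition _ := Choice.on suspension.
HB.instance Definition _ := EqQuotient.on suspension.

Definition susp_class (u : presuspension) : suspension := \pi_suspension u.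

(* The flow through (x, s) is at time t at (f^n x, s + t - S_n), for any n such
   that this lies below the graph of tau, where S_n is the n-th Birkhoff sum of
   tau at x. This is a flow, and the only one to satisfy
   phi_t (x, s) = (x, s + t) for s + t in [0, tau x]: see suspension_flow_local,
   suspension_flow0, suspension_flowD and suspension_flow_unique. *)
Definition suspension_flow (t : R) (p : suspension) : suspension :=
  xget p [set q | exists (u v : presuspension) (n : int),
    [/\ p = susp_class u, q = susp_class v,
        (val v).1 = iterz f n (val u).1 &
        (val v).2 = (val u).2 + t -
          psumz (fun i => tau (iterz f i (val u).1)) n]].

End suspension.

Notation unit_suspension f := (suspension f (fun=> 1)).

Section identification.
Context {R : realType} {X : metricType R} (f : homeomorphism X) (tau : X -> R).

Fact to_unit_subproof (u : presuspension tau) :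
  0 <= (val u).2 / tau (val u).1 <= 1.
Proof.
case: u => -[x t] /= /andP[t0 tt].
rewrite divr_ge0 ?(le_trans t0 tt)//=.
have [->|tau0] := eqVneq (tau x) 0; first by rewrite invr0 mulr0.
by rewrite ler_pdivrMr ?mul1r// lt_neqAle eq_sym tau0 (le_trans t0 tt).
Qed.

Definition pre_to_unit (u : presuspension tau) :
    presuspension (fun=> 1 : R) :=
  exist _ ((val u).1, (val u).2 / tau (val u).1) (to_unit_subproof u).

Definition to_unit (p : suspension f tau) : unit_suspension f :=
  susp_class f (pre_to_unit (repr p)).

Hypothesis tau_gt0 : forall x, 0 < tau x.

Fact from_unit_subproof (u : presuspension (fun=> 1 : R)) :
  0 <= (val u).2 * tau (val u).1 <= tau (val u).1.
Proof.
case: u => -[x t] /= /andP[t0 t1].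
by rewrite mulr_ge0 ?(ltW (tau_gt0 x))//= ler_piMl// ltW.
Qed.

Definition pre_from_unit (u : presuspension (fun=> 1 : R)) :
    presuspension tau :=
  exist _ ((val u).1, (val u).2 * tau (val u).1) (from_unit_subproof u).

Definition from_unit (p : unit_suspension f) : suspension f tau :=
  susp_class f (pre_from_unit (repr p)).

End identification.

Section bowen_walters.
Context {R : realType} {X : metricType R}.
Variable d : X -> X -> R.

Definition is_metric :=
  [/\ forall x y, d x y = 0 <-> x = y,
      forall x y, d x y = d y x &
      forall x y z, d x z <= d x y + d y z].

Definition induces_topology :=
  forall (x : X) (A : set X),
    nbhs x A <-> exists2 e : R, 0 < e & [set y | d x y < e] `<=` A.

Definition diameter : R := sup [set d z.1 z.2 | z in [set: X * X]].

(* A metric of diameter 1 equivalent to the given one; a space with at most one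
   point has none, and is left alone. *)
Definition normalized_metric :=
  [/\ is_metric, induces_topology &
      (exists x y : X, x <> y) -> diameter = 1].

Variable f : homeomorphism X.
Local Notation X1 := (unit_suspension f).

Definition orbit_time (p q : X1) : R :=
  inf [set `|s| | s in [set s | suspension_flow s p = q]].

Inductive bw_segment : X1 -> X1 -> R -> Prop :=
| BWHorizontal (u v : presuspension (fun=> 1 : R)) (t := (val u).2) :
    t = (val v).2 ->
    bw_segment (susp_class f u) (susp_class f v)
      ((1 - t) * d (val u).1 (val v).1 + t * d (f (val u).1) (f (val v).1))
| BWVertical (p : X1) (s : R) (q := suspension_flow s p) :
    bw_segment p q (orbit_time p q).

Inductive bw_path : X1 -> X1 -> R -> Prop :=
| BWNil p : bw_path p p 0
| BWCons p q r a b : bw_segment p q a -> bw_path q r b -> bw_path p r (a + b).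

Definition bw_dist1 (p q : X1) : R := inf [set l | bw_path p q l].

Definition bw_dist (tau : X -> R) (p q : suspension f tau) : R :=
  bw_dist1 (to_unit p) (to_unit q).

End bowen_walters.

Section iteration.
Context {X : topologicalType} (f : homeomorphism X).

Lemma iterzS n x : iterz f (n + 1) x = f (iterz f n x).
Proof.
case: n => [m|m].
  have -> : Posz m + 1 = Posz m.+1 by rewrite -PoszD addn1.
  by [].
case: m => [|m].
  have -> : Negz 0 + 1 = 0 by [].
  by rewrite /= homeoVK.
have -> : Negz m.+1 + 1 = Negz m by rewrite !NegzE -addn1 PoszD opprD addrNK.
by rewrite /= homeoVK.
Qed.

Lemma int_shift_ind (P : int -> Prop) :
  P 0 -> (forall n, P n <-> P (n + 1)) -> forall n, P n.
Proof.
move=> P0 PS; elim/int_rec => [//|n IH|n IH].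
- by rewrite -addn1 PoszD; exact/(PS _).1.
- by apply/(PS _).2; rewrite -addn1 PoszD opprD addrNK.
Qed.

Lemma iterzD m n x : iterz f (m + n) x = iterz f m (iterz f n x).
Proof.
elim/int_shift_ind: m => [|m]; first by rewrite add0r.
by rewrite addrAC !iterzS; split=> [->//|/(can_inj (homeoK f))].
Qed.

Lemma psumz0 (R : zmodType) (t : int -> R) : psumz t 0 = 0.
Proof. exact: big_ord0. Qed.

Lemma psumzS (R : zmodType) (t : int -> R) n : psumz t (n + 1) = psumz t n + t n.
Proof.
case: n => [m|m].
  have -> : Posz m + 1 = Posz m.+1 by rewrite -PoszD addn1.
  by rewrite /= big_ord_recr.
case: m => [|m].
  have -> : Negz 0 + 1 = 0 by [].
  by rewrite /= big_ord0 big_ord1 addNr.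
have -> : Negz m.+1 + 1 = Negz m by rewrite !NegzE -addn1 PoszD opprD addrNK.
by rewrite /= [X in - X + _]big_ord_recr /= opprD addrNK.
Qed.

Lemma psumzD (R : zmodType) (tau : X -> R) m n x :
  psumz (fun i => tau (iterz f i x)) (m + n) =
  psumz (fun i => tau (iterz f i x)) n +
  psumz (fun i => tau (iterz f i (iterz f n x))) m.
Proof.
elim/int_shift_ind: m => [|m]; first by rewrite add0r /= big_ord0 addr0.
by rewrite addrAC !psumzS addrA iterzD; split=> [->//|/addIr].
Qed.

End iteration.

Section psumz_order.
Context {R : realType} (t : int -> R) (c : R).
Hypotheses (c0 : 0 < c) (ct : forall i, c <= t i).

Lemma psumz_nat_ge i (n : nat) : psumz t i + n%:R * c <= psumz t (i + n%:Z).
Proof.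
elim: n => [|n IH]; first by rewrite mul0r !addr0.
rewrite -addn1 PoszD addrA psumzS natrD mulrDl mul1r addrA.
by rewrite lerD.
Qed.

Lemma psumz_le i j : i <= j -> psumz t i <= psumz t j.
Proof.
move=> ij; have [n ->] : exists n : nat, j = i + n%:Z.
  by exists `|j - i|%N; rewrite gez0_abs ?subr_ge0// GRing.subrKC.
apply: le_trans (psumz_nat_ge i n).
by rewrite lerDl mulr_ge0// ltW.
Qed.

Lemma psumz_cover u : exists i, psumz t i <= u < psumz t (i + 1).
Proof.
pose N := Num.bound (`|u| / c).
have uN : `|u| < N%:R * c.
  by rewrite -ltr_pdivrMr// archi_boundP// divr_ge0// ltW.
have lo : psumz t (- N%:Z) <= u.
  have := psumz_nat_ge (- N%:Z) N.
  rewrite addNr psumz0.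
  by move: uN; rewrite ltr_norml => /andP[]; lra.
have ex : exists k : nat, u < psumz t (- N%:Z + k%:Z).
  exists (N + N)%N; rewrite PoszD addrA addNr.
  apply: lt_le_trans (psumz_nat_ge 0 N); rewrite psumz0 add0r.
  exact: le_lt_trans (ler_norm u) uN.
case: (ex_minnP ex) => -[|k] uk kmin.
  by move: uk; rewrite addr0 ltNge lo.
exists (- N%:Z + k%:Z).
rewrite -addrA -PoszD addn1 uk andbT leNgt; apply/negP => /kmin.
by rewrite ltnn.
Qed.

Lemma psumz_cover_unique u i j :
  psumz t i <= u < psumz t (i + 1) -> psumz t j <= u < psumz t (j + 1) -> i = j.
Proof.
move=> /andP[iu ui] /andP[ju uj].
apply/eqP; rewrite eq_le !leNgt -!lezD1; apply/andP; split; apply/negP.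
- by move=> /psumz_le; rewrite leNgt (le_lt_trans iu uj).
- by move=> /psumz_le; rewrite leNgt (le_lt_trans ju ui).
Qed.

Lemma starE {Y : Type} (phi : R -> Y -> Y) (x : int -> Y) u i :
  psumz t i <= u < psumz t (i + 1) -> star phi x t u = phi (u - psumz t i) (x i).
Proof.
move=> iu; rewrite /star; suff -> : xget 0 [set i | psumz t i <= u < psumz t (i + 1)] = i by [].
by apply: xget_unique => // j ju; exact: psumz_cover_unique iu.
Qed.

End psumz_order.

Section suspension_theory.
Context {R : realType} {X : metricType R} (f : homeomorphism X) (tau : X -> R).

Definition susp_shift (n : int) (p : X * R) : X * R :=
  (iterz f n p.1, p.2 - psumz (fun i => tau (iterz f i p.1)) n).

Lemma susp_shift0 p : susp_shift 0 p = p.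
Proof. by case: p => x s; rewrite /susp_shift /= big_ord0 subr0. Qed.

Lemma susp_shiftD m n p : susp_shift (m + n) p = susp_shift m (susp_shift n p).
Proof. by rewrite /susp_shift /= iterzD psumzD opprD addrA. Qed.

Lemma susp_shift_addr n p t :
  susp_shift n (p.1, p.2 + t) = ((susp_shift n p).1, (susp_shift n p).2 + t).
Proof. by rewrite /susp_shift /= addrAC. Qed.

Lemma susp_class_shift u v :
  susp_class f u = susp_class f v :> suspension f tau ->
  exists n, val v = susp_shift n (val u).
Proof.
rewrite /susp_class => /eqmodP/asboolP.
elim=> {u v} [u v [uE vE]|u|u v _ [n E]|u v w _ [m E] _ [n E']].
- exists 1; rewrite /susp_shift /= big_ord1 /= vE.
  by rewrite uE subrr.
- by exists 0; rewrite susp_shift0.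
- by exists (- n); rewrite E -susp_shiftD addNr susp_shift0.
- by exists (n + m); rewrite E' E susp_shiftD.
Qed.

Lemma susp_class_glue u v : glue f u v -> susp_class f u = susp_class f v :> suspension f tau.
Proof. by move=> uv; apply/eqmodP/asboolP; exact: rst_step. Qed.

Hypothesis tau_gt0 : forall x, 0 < tau x.

Lemma shift_nat_susp_class (n : nat) (u v : presuspension tau) :
  val v = susp_shift n%:Z (val u) -> susp_class f u = susp_class f v.
Proof.
case: n => [|n] E.
  by move: E; rewrite susp_shift0 => /val_inj ->.
have tn (k : nat) x : 0 <= psumz (fun i => tau (iterz f i x)) k%:Z.
  by rewrite /= sumr_ge0// => i _; rewrite ltW.
have /andP[v0 _] := valP v; have /andP[_ u1] := valP u.
move: E v0; rewrite -addn1 PoszD susp_shiftD => E.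
rewrite E /susp_shift /= !big_ord1 /= => h.
have /= := tn n (f (val u).1) => h2.
have us : (val u).2 = tau (val u).1.
  by apply/eqP; rewrite eq_le u1 /= -subr_ge0; apply: le_trans h _; lra.
apply: susp_class_glue; split=> //.
case: n E h h2 => [|n] E h h2.
  by rewrite E susp_shift0 /susp_shift /= big_ord1 us subrr.
exfalso; move: h; rewrite us subrr sub0r oppr_ge0 big_ord_recl /=.
apply/negP; rewrite -ltNge ltr_wpDr// ?tau_gt0//.
by rewrite sumr_ge0// => i _; rewrite ltW.
Qed.

Lemma shift_susp_class n (u v : presuspension tau) :
  val v = susp_shift n (val u) -> susp_class f u = susp_class f v.
Proof.
case: n => n E; first exact: shift_nat_susp_class E.
apply/esym/(@shift_nat_susp_class n.+1).
by rewrite E -susp_shiftD NegzE addrN susp_shift0.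
Qed.

Lemma suspension_flowE t n (u v : presuspension tau) :
  val v = susp_shift n ((val u).1, (val u).2 + t) ->
  suspension_flow t (susp_class f u) = susp_class f v.
Proof.
move=> E; apply: xget_unique.
  by exists u, v, n; rewrite E; split.
move=> q [u' [v' [n' [/susp_class_shift[k uu'] -> E1 E2]]]].
apply/esym/(@shift_susp_class (n' + k - n)).
rewrite E -susp_shiftD subrK susp_shiftD.
rewrite susp_shift_addr -uu'.
by rewrite [LHS]surjective_pairing E1 E2.
Qed.

Lemma suspension_flow_local t (u v : presuspension tau) :
  val v = ((val u).1, (val u).2 + t) ->
  suspension_flow t (susp_class f u) = susp_class f v.
Proof. by move=> E; apply: (@suspension_flowE t 0); rewrite susp_shift0. Qed.

Lemma susp_class_repr (p : suspension f tau) : susp_class f (repr p) = p.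
Proof. exact: reprK. Qed.

Lemma suspension_flow0 (p : suspension f tau) : suspension_flow 0 p = p.
Proof.
rewrite -(susp_class_repr p); apply: suspension_flow_local.
by rewrite addr0 -surjective_pairing.
Qed.

Hypotheses (cptX : compact [set: X]) (ctau : continuous tau).

Lemma height_lower_bound : exists2 c, 0 < c & forall x, c <= tau x.
Proof.
have [X0|X0] := pselect ([set: X] !=set0); last first.
  by exists 1 => // x; exfalso; apply: X0; exists x.
have [|c _ cP] := compact_EVT_min X0 cptX (f := tau).
  exact: continuous_subspaceT.
by exists (tau c) => // x; apply: cP; rewrite inE.
Qed.

Lemma suspension_flow_exists t (p : suspension f tau) :
  exists (u v : presuspension tau) n,
    p = susp_class f u /\ val v = susp_shift n ((val u).1, (val u).2 + t).
Proof.
have [c c0 ctau'] := height_lower_bound.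
pose u := repr p; pose x := (val u).1.
have [n /andP[n1 n2]] :=
  @psumz_cover _ (fun i => tau (iterz f i x)) c c0 (fun i => ctau' _) ((val u).2 + t).
have vP : 0 <= (susp_shift n (x, (val u).2 + t)).2 <=
          tau (susp_shift n (x, (val u).2 + t)).1.
  by move: n1 n2; rewrite /susp_shift /= psumzS; lra.
exists u, (exist _ (susp_shift n (x, (val u).2 + t)) vP), n; split=> //.
by rewrite susp_class_repr.
Qed.

Lemma suspension_flowD s t (p : suspension f tau) :
  suspension_flow (s + t) p = suspension_flow s (suspension_flow t p).
Proof.
have [u [v [n [-> vE]]]] := suspension_flow_exists t p.
rewrite (suspension_flowE vE).
have [v' [w [m [vv' wE]]]] := suspension_flow_exists s (susp_class f v).
rewrite vv' (suspension_flowE wE).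
have [k kE] := susp_class_shift vv'.
apply: (@suspension_flowE _ (m + (k + n))).
rewrite wE !susp_shiftD; congr (susp_shift m _); rewrite (addrC s) addrA.
by rewrite (susp_shift_addr n (_, _)) -vE susp_shift_addr -kE.
Qed.

Lemma suspension_flow_unique (phi : R -> suspension f tau -> suspension f tau) :
  (forall p, phi 0 p = p) ->
  (forall s t p, phi (s + t) p = phi s (phi t p)) ->
  (forall t u v, val v = ((val u).1, (val u).2 + t) ->
    phi t (susp_class f u) = susp_class f v) ->
  phi = @suspension_flow R X f tau.
Proof.
move=> phi0 phiD phiL.
have [c c0 cle] := height_lower_bound.
have small t p : 0 <= t <= c -> phi t p = suspension_flow t p.
  move=> /andP[t0 tc]; rewrite -(susp_class_repr p); set u := repr p.
  have /andP[u0 u1] := valP u; set x := (val u).1 in u1 *; set s := (val u).2 in u0 u1 *.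
  have [st|st] := leP (s + t) (tau x).
    have vP : 0 <= (x, s + t).2 <= tau (x, s + t).1 by rewrite /= st addr_ge0.
    pose v : presuspension tau := exist _ (x, s + t) vP.
    by rewrite (phiL _ u v)// (suspension_flow_local (u := u) (v := v)).
  have aP : 0 <= (x, tau x).2 <= tau (x, tau x).1 by rewrite /= lexx ltW.
  have bP : 0 <= (f x, 0 : R).2 <= tau (f x, 0 : R).1 by rewrite /= lexx ltW.
  have wP : 0 <= (f x, s + t - tau x).2 <= tau (f x, s + t - tau x).1.
    by rewrite /=; have := cle (f x); lra.
  pose a : presuspension tau := exist _ (x, tau x) aP.
  pose b : presuspension tau := exist _ (f x, 0) bP.
  pose w : presuspension tau := exist _ (f x, s + t - tau x) wP.
  have tE : t = (s + t - tau x) + (tau x - s) by lra.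
  have ua : val a = ((val u).1, (val u).2 + (tau x - s)).
    by rewrite /= -/s; congr pair; lra.
  have ab : susp_class f a = susp_class f b by exact: susp_class_glue.
  have bw : val w = ((val b).1, (val b).2 + (s + t - tau x)) by rewrite /= add0r.
  rewrite tE phiD suspension_flowD (phiL _ _ _ ua) (suspension_flow_local ua) ab.
  by rewrite (phiL _ _ _ bw) (suspension_flow_local bw).
have pos t p : 0 <= t -> phi t p = suspension_flow t p.
  move=> t0; pose N := (Num.bound (t / c)).+1.
  have step : 0 <= t / N%:R <= c.
    rewrite divr_ge0//= ler_pdivrMr ?ltr0n// mulrC -ler_pdivrMr//.
    apply: le_trans (ltW (archi_boundP _)) _; first by rewrite divr_ge0// ltW.
    by rewrite ler_nat.
  have -> : t = (t / N%:R) *+ N by rewrite -[RHS]mulr_natr divfK// pnatr_eq0.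
  elim: N {step} (t / N%:R) step p => [|N IH] r step p.
    by rewrite mulr0n phi0 suspension_flow0.
  by rewrite mulrSr phiD suspension_flowD (small r)// IH.
apply/funext => t; apply/funext => p.
have [/pos//|t0] := leP 0 t.
have -> : phi t p = phi t (suspension_flow (- t) (suspension_flow t p)).
  by rewrite -suspension_flowD addNr suspension_flow0.
by rewrite -(pos (- t)) ?oppr_ge0 1?ltW// -phiD addrN phi0.
Qed.

End suspension_theory.

Section identification_theory.
Context {R : realType} {X : metricType R} (f : homeomorphism X) (tau : X -> R).

Lemma susp_class_lift T (g : presuspension tau -> T) :
  (forall u v, glue f u v -> g u = g v) ->
  forall u v, susp_class f u = susp_class f v -> g u = g v.
Proof.
move=> gglue u v /eqmodP/asboolP.
by elim=> {u v} [u v /gglue|//|u v _ ->|u v w _ -> _ ->].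
Qed.

Hypothesis tau_gt0 : forall x, 0 < tau x.

Lemma to_unitE (u : presuspension tau) :
  to_unit (susp_class f u) = susp_class f (pre_to_unit u).
Proof.
apply: (@susp_class_lift _ (fun u => susp_class f (pre_to_unit u))); last first.
  exact: susp_class_repr.
move=> {}u v [uE vE]; apply: susp_class_glue; split; rewrite /= ?vE.
- by rewrite uE divff// gt_eqF.
- by rewrite /= mul0r.
Qed.

End identification_theory.

Section identification_theory_unit.
Context {R : realType} {X : metricType R} (f : homeomorphism X) (tau : X -> R).
Hypothesis tau_gt0 : forall x, 0 < tau x.

Lemma from_unitE (u : presuspension (fun=> 1 : R)) :
  from_unit tau_gt0 (susp_class f u) = susp_class f (pre_from_unit tau_gt0 u).
Proof.
apply: (susp_class_lift (g := fun u => susp_class f (pre_from_unit tau_gt0 u)));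
  last exact: susp_class_repr.
move=> {}u v [uE vE]; apply: susp_class_glue; split; rewrite /= ?vE.
- by rewrite uE mul1r.
- by rewrite /= mul0r.
Qed.

Lemma to_unitK : cancel (@to_unit R X f tau) (from_unit tau_gt0).
Proof.
move=> p; rewrite -(susp_class_repr p) to_unitE// from_unitE; congr susp_class.
by apply/val_inj; rewrite /= divfK ?gt_eqF// -surjective_pairing.
Qed.

Lemma from_unitK : cancel (from_unit tau_gt0) (@to_unit R X f tau).
Proof.
move=> p; rewrite -(susp_class_repr p) from_unitE to_unitE//; congr susp_class.
by apply/val_inj; rewrite /= mulfK ?gt_eqF// -surjective_pairing.
Qed.

End identification_theory_unit.

(* Main.v *)
Require Import Defs.
From mathcomp Require Import all_boot all_order all_algebra.
From mathcomp Require Import all_classical all_reals all_analysis.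
From mathcomp Require Import lra zify.

(** Points of the suspension are handled through the covering map
    (x, r) |-> (point reached from (x, 0) after time r) from X * R, on which the
    flow is the translation of r and two pairs have the same image if and only
    if one is (f^n x, r - S_n x), S_n the n-th return time, and the other
    (x, r). The one fact needed about the Bowen-Walters distance is that it
    defines the product uniformity in this cover: a point close to the image
    of (b, s) has a lift close to (b, s) (bw_dist_lift), and conversely close
    lifts have close images (bw_dist_le). The first statement comes from
    lifting short paths, in the chart of heights around the base where
    horizontal lengths control the distance of base points (bw_path_lift).

    Suppose x is shadowable for f, and consider a flow pseudo-orbit through
    (x, s). It is close to a true orbit over any bounded time, so it can be
    sampled at the multiples of a large time T. The base points of the
    samples, continued by f until the next sample, form a pseudo-orbit of f
    through x; a point q which shadows it yields a shadowing flow orbit, whose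
    reparametrization is affine between the times at which the orbit of q
    reaches the heights of the samples (shadowable_flow_of_shadowable).

    Suppose conversely that (x, s) is shadowable for the flow. A pseudo-orbit of
    f through x gives a flow pseudo-orbit through (x, s), in which all points
    are at the same fraction of their towers and each step makes N returns, N
    being large enough for the steps to last at least 1. A reparametrized orbit
    that shadows it must make exactly N returns during each step: the
    discrepancy between the two clocks is continuous and always close to a
    return time, and return times are separated (locked_returns). Hence the
    base points of the shadowing orbit shadow the pseudo-orbit of f
    (shadowable_of_shadowable_flow). *)

Set Implicit Arguments.
Unset Strict Implicit.
Unset Printing Implicit Defensive.

Import Order.TTheory GRing.Theory Num.Theory.
Import numFieldNormedType.Exports.

Local Open Scope classical_set_scope.
Local Open Scope ring_scope.

(** * Uniform continuity on a compact space *)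

Section uniformity.
Context {R : realType} {X : metricType R}.
Hypothesis cptX : compact [set: X].

(** Heine's theorem for an arbitrary pair of pseudodistances. The generality is
    used for D the distance of X or an equivalent metric, and for E one of
    these, its pullback along a map, or a difference of heights. *)
Lemma uniform_of_local (D E : X -> X -> R) :
  (forall x y, D x y = D y x) -> (forall x y z, D x z <= D x y + D y z) ->
  (forall x y, E x y = E y x) -> (forall x y z, E x z <= E x y + E y z) ->
  (forall x e, 0 < e -> nbhs x [set y | D x y < e]) ->
  (forall x e, 0 < e ->
    exists2 e', 0 < e' & forall y, D x y < e' -> E x y < e) ->
  forall e, 0 < e -> exists2 e', 0 < e' & forall x y, D x y <= e' -> E x y <= e.
Proof.
move=> Dsym Dtri Esym Etri nbhsD DE e e0.
pose P (h : R) (x : X) := forall y, D x y <= h -> E x y <= e.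
have : \forall h \near (0 : R)^'+, [set: X] `<=` P h.
  apply: ((compact_near_coveringP _).1 cptX) => x _.
  have e20 : 0 < e / 2 by rewrite divr_gt0.
  have [e' e'0 e'E] := DE x (e / 2) e20.
  have e'20 : 0 < e' / 2 by rewrite divr_gt0.
  exists ([set y | D x y < e' / 2], [set h : R | h < e' / 2]) => /=.
    by split; [exact: nbhsD|exact: nbhs_right_lt].
  move=> [x' h] /= [xx' h2] y x'y.
  have D1 : D x y < e' by have := Dtri x x' y; lra.
  have D2 : D x x' < e' by lra.
  have := Etri x' x y; rewrite (Esym x' x).
  by have := e'E _ D1; have := e'E _ D2; lra.
move=> nearP.
have /filter_ex[h [h0 Ph]] :
    \forall h \near (0 : R)^'+, 0 < h /\ [set: X] `<=` P h.
  by apply: filterI => //; exact: nbhs_right_gt.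
by exists h => // x y; exact: Ph.
Qed.

Lemma nbhs_mdist (x : X) e : 0 < e -> nbhs x [set y | mdist x y < e].
Proof. by move=> e0; rewrite -ballEmdist; exact: nbhsx_ballx. Qed.

Lemma continuous_mdist (Y : metricType R) (g : X -> Y) (x : X) (e : R) :
  continuous g -> 0 < e ->
  exists2 e', 0 < e' & forall y, mdist x y < e' -> mdist (g x) (g y) < e.
Proof.
move=> cg e0.
have /nbhs_ballP[e' e'0 e'P] : nbhs x (g @^-1` [set y | mdist (g x) y < e]).
  by apply: cg; rewrite -ballEmdist; exact: nbhsx_ballx.
by exists e' => // y xy; apply: e'P; rewrite ballEmdist.
Qed.

Lemma unif_continuous_mdist (Y : metricType R) (g : X -> Y) : continuous g ->
  forall e, 0 < e ->
  exists2 e', 0 < e' & forall x y, mdist x y <= e' -> mdist (g x) (g y) <= e.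
Proof.
move=> cg; apply: (uniform_of_local (E := fun x y => mdist (g x) (g y))).
- exact: metric_sym.
- exact: metric_triangle.
- by move=> x y; exact: metric_sym.
- by move=> x y z; exact: metric_triangle.
- exact: nbhs_mdist.
- by move=> x e; exact: continuous_mdist.
Qed.

Lemma unif_continuous_height (tau : X -> R) : continuous tau ->
  forall e, 0 < e ->
  exists2 e', 0 < e' & forall x y, mdist x y <= e' -> `|tau x - tau y| <= e.
Proof.
move=> ctau; apply: (uniform_of_local (E := fun x y => `|tau x - tau y|)).
- exact: metric_sym.
- exact: metric_triangle.
- by move=> x y; exact: distrC.
- by move=> x y z; exact: ler_distD.
- exact: nbhs_mdist.
- move=> x e e0.
  have /nbhs_ballP[e' e'0 e'P] : nbhs x [set y | `|tau x - tau y| < e].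
    by have /cvgrPdist_lt := ctau x; apply.
  by exists e' => // y xy; apply: e'P; rewrite ballEmdist.
Qed.

Variable d : X -> X -> R.
Hypotheses (dm : is_metric d) (dt : induces_topology d).

Lemma metric_le_mdist e : 0 < e ->
  exists2 e', 0 < e' & forall x y, mdist x y <= e' -> d x y <= e.
Proof.
move: e; have [_ dsym dtri] := dm.
apply: uniform_of_local => //.
- exact: metric_sym.
- exact: metric_triangle.
- exact: nbhs_mdist.
move=> x e e0.
have /nbhs_ballP[e' e'0 e'P] : nbhs x [set y | d x y < e] by apply/dt; exists e.
by exists e' => // y xy; apply: e'P; rewrite ballEmdist.
Qed.

Lemma mdist_le_metric e : 0 < e ->
  exists2 e', 0 < e' & forall x y, d x y <= e' -> mdist x y <= e.
Proof.
move: e; have [_ dsym dtri] := dm.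
apply: uniform_of_local => //; [exact: metric_sym|exact: metric_triangle| |].
- by move=> x e e0; apply/dt; exists e.
- by move=> x e /(nbhs_mdist x)/dt[e' e'0 e'P]; exists e'.
Qed.

End uniformity.

(** * The covering of a suspension by X * R *)

Section cover.
Context {R : realType} {X : metricType R} (f : homeomorphism X) (tau : X -> R).
Hypothesis tau_gt0 : forall x, 0 < tau x.

(** The time that the orbit of (x, 0) takes to make n returns to the base. *)
Definition birkhoff (n : int) (x : X) : R := psumz (fun i => tau (iterz f i x)) n.

Lemma birkhoff0 x : birkhoff 0 x = 0.
Proof. exact: psumz0. Qed.

Lemma birkhoffS n x : birkhoff (n + 1) x = birkhoff n x + tau (iterz f n x).
Proof. exact: psumzS. Qed.

Lemma birkhoffD m n x : birkhoff (m + n) x = birkhoff n x + birkhoff m (iterz f n x).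
Proof. exact: psumzD. Qed.

Lemma birkhoff1 x : birkhoff 1 x = tau x.
Proof. by rewrite -[1]add0r birkhoffS birkhoff0 add0r. Qed.

Fact cover_base_subproof (x : X) : 0 <= (x, 0 : R).2 <= tau (x, 0 : R).1.
Proof. by rewrite /= lexx ltW. Qed.

(** The covering map from X * R onto the suspension: (x, r) goes to the point
    reached from (x, 0) after time r. Heights r are unrestricted, the flow
    becomes a translation in r, and the deck transformations are the shifts
    (x, r) |-> (f^n x, r - S_n x), where S_n is the n-th return time. *)
Definition cover_point (x : X) (r : R) : suspension f tau :=
  suspension_flow r (susp_class f
    (exist (fun p : X * R => 0 <= p.2 <= tau p.1) (x, 0) (cover_base_subproof x))).

Lemma cover_pointE n x r (v : presuspension tau) :
  val v = susp_shift f tau n (x, r) -> cover_point x r = susp_class f v.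
Proof. by move=> vE; apply: (suspension_flowE tau_gt0 (n := n)); rewrite /= add0r. Qed.

Lemma cover_point_class (u : presuspension tau) :
  susp_class f u = cover_point (val u).1 (val u).2.
Proof. by rewrite (@cover_pointE 0 _ _ u)// susp_shift0 -surjective_pairing. Qed.

Lemma cover_point_surj (p : suspension f tau) :
  exists x r, 0 <= r <= tau x /\ p = cover_point x r.
Proof.
exists (val (repr p)).1, (val (repr p)).2; split; first exact: (valP (repr p)).
by rewrite -cover_point_class susp_class_repr.
Qed.

Hypotheses (cptX : compact [set: X]) (ctau : continuous tau).

(** Return times tend to infinity in both directions because tau is bounded
    below by a positive constant, so every pair has a deck translate below the
    graph of tau. *)
Lemma shift_canonical x r : exists (v : presuspension tau) n,
  val v = susp_shift f tau n (x, r).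
Proof.
have [c c0 ctau'] := height_lower_bound tau_gt0 cptX ctau.
have [n /andP[n1 n2]] :=
  @psumz_cover _ (fun i => tau (iterz f i x)) c c0 (fun i => ctau' _) r.
have vP : 0 <= (susp_shift f tau n (x, r)).2 <= tau (susp_shift f tau n (x, r)).1.
  by move: n1 n2; rewrite /susp_shift /= psumzS; lra.
by exists (exist _ (susp_shift f tau n (x, r)) vP), n.
Qed.

Lemma cover_point_shift n x r :
  cover_point (iterz f n x) (r - birkhoff n x) = cover_point x r.
Proof.
have [v [m vE]] := shift_canonical x r.
rewrite (cover_pointE vE); apply: (@cover_pointE (m - n)).
by rewrite -[(_, r - _)]/(susp_shift f tau n (x, r)) -susp_shiftD subrK.
Qed.

Lemma cover_pointS x r : cover_point (f x) (r - tau x) = cover_point x r.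
Proof. by rewrite -(cover_point_shift 1 x r) birkhoff1. Qed.

Lemma cover_pointV x r :
  cover_point (homeo_inv f x) (r + tau (homeo_inv f x)) = cover_point x r.
Proof. by rewrite -cover_pointS homeoVK addrK. Qed.

Lemma cover_point_inj x r y s : cover_point x r = cover_point y s ->
  exists n, y = iterz f n x /\ s = r - birkhoff n x.
Proof.
have [v [m vE]] := shift_canonical x r; rewrite (cover_pointE vE).
have [w [k wE]] := shift_canonical y s; rewrite (cover_pointE wE).
move=> /susp_class_shift[n nE].
have E : (y, s) = susp_shift f tau (- k + (n + m)) (x, r).
  by rewrite !susp_shiftD -vE -nE wE -susp_shiftD addNr susp_shift0.
by exists (- k + (n + m)); case: E => -> ->.
Qed.

Lemma cover_point_flow t x r :
  suspension_flow t (cover_point x r) = cover_point x (r + t).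
Proof. by rewrite addrC /cover_point -(suspension_flowD tau_gt0 cptX ctau) addrC. Qed.

End cover.

(** * The Bowen-Walters distance on the unit suspension *)

Lemma unit_height_gt0 (R : realType) (X : metricType R) (x : X) :
  0 < (fun=> 1 : R) x.
Proof. exact: ltr01. Qed.

Section bowen_walters_metric.
Context {R : realType} {X : metricType R} (f : homeomorphism X).
Variable d : X -> X -> R.
Hypotheses (cptX : compact [set: X]) (dm : is_metric d).

Local Notation X1 := (suspension f (fun=> 1 : R)).
Local Notation cover1 := (cover_point f (@unit_height_gt0 R X)).
Local Notation cone := (fun x : X => @cst_continuous X R 1 x).
Local Notation flow1 := (@suspension_flow R X f (fun=> 1)).

Let unit_flowE t x r : flow1 t (cover1 x r) = cover1 x (r + t).
Proof. exact: (cover_point_flow f (@unit_height_gt0 R X) cptX cone). Qed.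

Let unit_flowK s : cancel (flow1 s) (flow1 (- s)).
Proof.
move=> p; rewrite -(suspension_flowD (@unit_height_gt0 R X) cptX cone) addNr.
exact: (suspension_flow0 (@unit_height_gt0 R X)).
Qed.

Lemma is_metric_xx x : d x x = 0.
Proof. by have [d0 _ _] := dm; apply/d0. Qed.

Lemma is_metric_ge0 x y : 0 <= d x y.
Proof.
have [d0 dsym dtri] := dm.
by have := dtri x y x; rewrite is_metric_xx (dsym y x); lra.
Qed.

Lemma birkhoff_unit n x : birkhoff f (fun=> 1 : R) n x = n%:~R.
Proof.
elim/int_shift_ind: n => [|n]; first exact: birkhoff0.
by rewrite birkhoffS intrD mulr1z; split=> [->//|/addIr].
Qed.

Lemma orbit_time_ge0 (p q : X1) : 0 <= orbit_time p q.
Proof.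
rewrite /orbit_time; set E := (X in inf X).
have [E0|/set0P/negP/negPn/eqP->] := pselect (E !=set0); last by rewrite inf0.
by apply: lb_le_inf => // _ [s _ <-].
Qed.

Lemma orbit_time_le (p : X1) s : orbit_time p (flow1 s p) <= `|s|.
Proof. by apply: ge_inf; [exists 0 => _ [? _ <-]|exists s]. Qed.

Lemma orbit_time_lt (p : X1) s0 l : orbit_time p (flow1 s0 p) < l ->
  exists2 s, flow1 s p = flow1 s0 p & `|s| < l.
Proof.
pose E := [set `|s| | s in [set s | flow1 s p = flow1 s0 p]].
rewrite -subr_gt0 => /inf_adherent => /(_ E).
case; first by split; [exists `|s0|, s0|exists 0 => _ [? _ <-]].
by move=> _ [s sE <-]; rewrite addrC subrK; exists s.
Qed.

Lemma orbit_time_sym (p q : X1) : orbit_time p q = orbit_time q p.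
Proof.
rewrite /orbit_time; congr inf; apply/seteqP.
suff H (p' q' : X1) : [set `|s| | s in [set s | flow1 s p' = q']] `<=`
    [set `|s| | s in [set s | flow1 s q' = p']] by split; exact: H.
move=> _ [s <- <-]; exists (- s); last exact: normrN.
exact: unit_flowK.
Qed.

Lemma bw_segment_ge0 (p q : X1) l : bw_segment d p q l -> 0 <= l.
Proof.
case=> [u v|{}p s]; last exact: orbit_time_ge0.
have /andP[u0 u1] := valP u; move: u0 u1 => /= u0 u1 _.
have := is_metric_ge0 (val u).1 (val v).1.
have := is_metric_ge0 (f (val u).1) (f (val v).1).
by move=> h1 h2; rewrite addr_ge0// mulr_ge0// subr_ge0.
Qed.

Lemma bw_path_ge0 (p q : X1) l : bw_path d p q l -> 0 <= l.
Proof.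
by elim=> // {}p {}q r a b /bw_segment_ge0 a0 _ b0; rewrite addr_ge0.
Qed.

Lemma bw_segment_sym (p q : X1) l : bw_segment d p q l -> bw_segment d q p l.
Proof.
have [_ dsym _] := dm.
case=> [u v t tv|{}p s q0].
  rewrite (dsym (val u).1) (dsym (f _)) /t (tv : (val u).2 = _).
  by have := @BWHorizontal _ _ d f v u (esym tv).
rewrite /q0 orbit_time_sym -{2 4}(unit_flowK s p); exact: BWVertical.
Qed.

Lemma bw_path_cat (p q r : X1) a b :
  bw_path d p q a -> bw_path d q r b -> bw_path d p r (a + b).
Proof.
elim=> [{}p|{}p {}q s {}a c pq _ IH] qr; first by rewrite add0r.
by rewrite -addrA; apply: BWCons pq _; exact: IH.
Qed.

Lemma bw_segment_path (p q : X1) l : bw_segment d p q l -> bw_path d p q l.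
Proof. by move=> pq; rewrite -[l]addr0; apply: BWCons pq (BWNil _ _). Qed.

Lemma bw_path_sym (p q : X1) l : bw_path d p q l -> bw_path d q p l.
Proof.
elim=> [{}p|{}p {}q r a b pq _ rq]; first exact: BWNil.
by rewrite addrC; apply: bw_path_cat rq _; exact/bw_segment_path/bw_segment_sym.
Qed.

Lemma bw_path_horizontal x y t : 0 <= t <= 1 ->
  bw_path d (cover1 x t) (cover1 y t) ((1 - t) * d x y + t * d (f x) (f y)).
Proof.
move=> t01.
pose u : presuspension (fun=> 1) := exist (fun p : X * R => 0 <= p.2 <= 1) (x, t) t01.
pose v : presuspension (fun=> 1) := exist (fun p : X * R => 0 <= p.2 <= 1) (y, t) t01.
rewrite -[cover1 x t](@cover_point_class _ _ _ _ (@unit_height_gt0 R X) u).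
rewrite -[cover1 y t](@cover_point_class _ _ _ _ (@unit_height_gt0 R X) v).
by apply: bw_segment_path; exact: (@BWHorizontal _ _ d f u v).
Qed.

Lemma bw_path_vertical x r s : exists2 l, l <= `|r - s| &
  bw_path d (cover1 x r) (cover1 x s) l.
Proof.
have E : cover1 x s = flow1 (s - r) (cover1 x r).
  by rewrite unit_flowE addrCA subrr addr0.
exists (orbit_time (cover1 x r) (cover1 x s)).
  by rewrite E distrC; exact: orbit_time_le.
by rewrite E; apply: bw_segment_path; exact: BWVertical.
Qed.

Lemma bw_path_ex (p q : X1) : exists l, bw_path d p q l.
Proof.
have [x [r [_ ->]]] := cover_point_surj (@unit_height_gt0 R X) p.
have [y [s [_ ->]]] := cover_point_surj (@unit_height_gt0 R X) q.
have [a _ pa] := bw_path_vertical x r 0; have [b _ pb] := bw_path_vertical y 0 s.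
have := @bw_path_horizontal x y 0; rewrite lexx ler01 => /(_ isT) ph.
by eexists; apply: bw_path_cat pa (bw_path_cat ph pb).
Qed.

Lemma bw_dist1_le (p q : X1) l : bw_path d p q l -> bw_dist1 d p q <= l.
Proof.
by move=> pq; apply: ge_inf => //; exists 0 => a; exact: bw_path_ge0.
Qed.

Lemma bw_dist1_lt (p q : X1) l : bw_dist1 d p q < l ->
  exists2 l', l' < l & bw_path d p q l'.
Proof.
rewrite -subr_gt0 => /inf_adherent => /(_ [set l | bw_path d p q l]).
case; first by split; [exact: bw_path_ex|exists 0 => a; exact: bw_path_ge0].
by move=> l' l'P; rewrite addrC subrK; exists l'.
Qed.

Lemma bw_dist1_sym (p q : X1) : bw_dist1 d p q = bw_dist1 d q p.
Proof.
by rewrite /bw_dist1; congr inf; apply/seteqP; split=> l; exact: bw_path_sym.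
Qed.

Lemma bw_dist1_triangle (p q r : X1) :
  bw_dist1 d p r <= bw_dist1 d p q + bw_dist1 d q r.
Proof.
apply/ler_addgt0Pr => e e0; have e20 : 0 < e / 2 by rewrite divr_gt0.
have [a al pa] : exists2 l', l' < bw_dist1 d p q + e / 2 & bw_path d p q l'.
  by apply: bw_dist1_lt; rewrite ltrDl.
have [b bl pb] : exists2 l', l' < bw_dist1 d q r + e / 2 & bw_path d q r l'.
  by apply: bw_dist1_lt; rewrite ltrDl.
by have := bw_dist1_le (bw_path_cat pa pb); lra.
Qed.

(** Horizontal segments are charged differently on the two sides of the gluing,
    but in the chart of heights in [-3/4, 3/4] around the base the separation
    of the base points is always controlled: at height t >= 0 the distance d
    has weight 1 - t, and at t < 0, that is at height t + 1 over the preimage,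
    it has weight t + 1. Both are at least 1/4, whence the factor 4. The slack
    e pays for the infimum in the length of a vertical segment. *)
Lemma bw_segment_lift (p q : X1) l e b s : bw_segment d p q l -> 0 < e ->
  q = cover1 b s -> `|s| + (l + e) <= 3 / 4 ->
  exists a r, [/\ p = cover1 a r, `|r - s| <= l + e & d a b <= 4 * (l + e)].
Proof.
move=> pq e0; have := bw_segment_ge0 pq; case: pq => {p q l} [u v t tv|p s0].
  have := is_metric_ge0 (val u).1 (val v).1.
  have := is_metric_ge0 (f (val u).1) (f (val v).1).
  rewrite (cover_point_class f (@unit_height_gt0 R X) v).
  rewrite (cover_point_class f (@unit_height_gt0 R X) u).
  have /andP[/= t0 t1] := valP u; rewrite -tv -/t in t0 t1 *.
  move: (val u).1 (val v).1 t t0 t1 {tv} => a y t t0 t1 h1 h2.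
  set l := (1 - t) * d a y + t * d (f a) (f y) => l0 qE sl.
  have [n [vn tn]] := cover_point_inj cptX cone qE.
  rewrite birkhoff_unit in tn.
  have : `|t - n%:~R| <= 3 / 4 by rewrite -tn; lra.
  rewrite ler_norml => /andP[h3 h4].
  have n1 : n%:~R < (2 : int)%:~R :> R by rewrite mulrz_nat; lra.
  have n2 : (- 1 : int)%:~R < n%:~R :> R by rewrite intrN mulr1z; lra.
  rewrite !ltr_int in n1 n2.
  (* The segment lies over the base point itself or over its preimage. *)
  have [nE|nE] : n = 0 \/ n = 1 by lia.
    subst n; rewrite mulr0z subr0 /= in vn tn; subst b s.
    exists a, t; rewrite subrr normr0; split=> //; first lra.
    rewrite ger0_norm// in sl.
    have h5 : 0 <= t * d (f a) (f y) by rewrite mulr_ge0.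
    have h6 : (1 / 4) * d a y <= (1 - t) * d a y by rewrite ler_wpM2r//; lra.
    by rewrite /l; lra.
  subst n; rewrite mulr1z /= in vn tn; subst b s.
  exists (f a), (t - 1); rewrite subrr normr0; split; [|lra|].
    exact/esym/(cover_pointS f (@unit_height_gt0 R X) cptX cone).
  rewrite ler0_norm in sl; last lra.
  have h5 : 0 <= (1 - t) * d a y by rewrite mulr_ge0// subr_ge0.
  have h6 : (1 / 4) * d (f a) (f y) <= t * d (f a) (f y).
    by rewrite ler_wpM2r//; lra.
  by rewrite /l; lra.
move=> q l0 qE sl.
have [s1 s1E s1l] : exists2 s1, flow1 s1 p = flow1 s0 p &
    `|s1| < orbit_time p (flow1 s0 p) + e by apply: orbit_time_lt; rewrite ltrDl.
exists b, (s - s1); split; last by rewrite is_metric_xx; lra.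
  by rewrite -unit_flowE -qE /q -s1E unit_flowK.
by rewrite addrAC subrr sub0r normrN ltW.
Qed.

(** A short path can be lifted to the cover from a prescribed lift of its
    endpoint, without leaving the chart around the base. *)
Lemma bw_path_lift (p q : X1) l : bw_path d p q l -> forall L b s,
  q = cover1 b s -> l < L -> `|s| + L <= 3 / 4 ->
  exists a r, [/\ p = cover1 a r, `|r - s| <= L & d a b <= 4 * L].
Proof.
have [_ _ dtri] := dm.
elim=> [{}p|{}p {}q r a1 b1 pq qr IH] L b s rE lL sL.
  by exists b, s; rewrite subrr normr0 is_metric_xx; split=> //; lra.
have b10 := bw_path_ge0 qr; have a10 := bw_segment_ge0 pq.
pose e := (L - a1 - b1) / 2; have e0 : 0 < e by rewrite /e; lra.
have eE : L = (b1 + e) + (a1 + e) by rewrite /e; lra.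
have [|//||a' [r' [qE r's da'b]]] := IH (b1 + e) b s; [|lra|lra|].
  by [].
have nr' : `|r'| <= `|s| + (b1 + e).
  by have := ler_normD (r' - s) s; rewrite subrK; lra.
have [|a [t [pE tr' daa']]] := bw_segment_lift pq e0 qE; first lra.
exists a, t; split=> //.
  by have := ler_distD r' t s; lra.
by have := dtri a a' b; lra.
Qed.

End bowen_walters_metric.

(** * The Bowen-Walters distance and the cover near the base *)

Section local_product.
Context {R : realType} {X : metricType R} (f : homeomorphism X) (tau : X -> R).
Variables (tau_gt0 : forall x, 0 < tau x) (d : X -> X -> R).
Hypotheses (cptX : compact [set: X]) (ctau : continuous tau).
Hypotheses (dm : is_metric d) (dt : induces_topology d).

Local Notation Y := (suspension f tau).
Local Notation cover := (cover_point f tau_gt0).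
Local Notation cover1 := (cover_point f (@unit_height_gt0 R X)).
Local Notation cone := (fun x : X => @cst_continuous X R 1 x).
Local Notation rho := (@bw_dist R X d f tau).
Local Notation finv := (homeo_inv f).

Lemma bw_dist_sym (p q : Y) : rho p q = rho q p.
Proof. exact: bw_dist1_sym. Qed.

Lemma bw_dist_triangle (p q r : Y) : rho p r <= rho p q + rho q r.
Proof. exact: bw_dist1_triangle. Qed.

Lemma height_upper_bound : exists2 C, 0 < C & forall x, tau x <= C.
Proof.
have [X0|X0] := pselect ([set: X] !=set0); last first.
  by exists 1 => // x; exfalso; apply: X0; exists x.
have [|c _ cP] := compact_EVT_max X0 cptX (f := tau).
  exact: continuous_subspaceT.
by exists (tau c) => // x; apply: cP; rewrite inE.
Qed.

(** Proximity in the cover, which is what the flow arguments manipulate in place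
    of the Bowen-Walters distance. *)
Definition near_lift (e : R) (a : X) (r : R) (b : X) (s : R) :=
  mdist a b <= e /\ `|r - s| <= e.

Lemma near_lift_shift e : 0 < e -> exists2 e', 0 < e' & forall a r b s,
  near_lift e' a r b s ->
  near_lift e (f a) (r - tau a) (f b) (s - tau b) /\
  near_lift e (finv a) (r + tau (finv a)) (finv b) (s + tau (finv b)).
Proof.
move=> e0; have e20 : 0 < e / 2 by rewrite divr_gt0.
have [h1 h10 h1P] := unif_continuous_height cptX ctau e20.
have [h2 h20 h2P] := unif_continuous_mdist cptX (@homeo_continuous _ f) e0.
have m0 : 0 < Num.min e h1 by rewrite lt_min e0.
have [h3 h30 h3P] := unif_continuous_mdist cptX (@homeo_inv_continuous _ f) m0.
exists (Num.min (e / 2) (Num.min h1 (Num.min h2 h3))) => [|a r b s].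
  by rewrite !lt_min e20 h10 h20.
rewrite /near_lift !le_min => -[/and4P[_ a1 a2 a3] /and4P[r1 _ _ _]].
have := h3P _ _ a3; rewrite le_min => /andP[a4 /h1P a5].
do 2!split=> //; first exact: h2P.
  have := h1P _ _ a1 => a6; have := ler_normB (r - s) (tau a - tau b).
  have -> : r - tau a - (s - tau b) = (r - s) - (tau a - tau b) by lra.
  by lra.
have := ler_normD (r - s) (tau (finv a) - tau (finv b)).
have -> : r + tau (finv a) - (s + tau (finv b)) =
  (r - s) + (tau (finv a) - tau (finv b)) by lra.
by lra.
Qed.

Lemma to_unit_cover_point x r : 0 <= r <= tau x ->
  to_unit (cover x r) = cover1 x (r / tau x).
Proof.
move=> r01; pose u : presuspension tau :=
  exist (fun p : X * R => 0 <= p.2 <= tau p.1) (x, r) r01.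
rewrite -[cover x r](cover_point_class f tau_gt0 u) to_unitE//.
by rewrite (cover_point_class f (@unit_height_gt0 R X)).
Qed.

Lemma to_unit_inj : injective (@to_unit R X f tau).
Proof. exact: can_inj (to_unitK tau_gt0). Qed.

(** The height of the tower in which a point of signed unit height t in [-1, 1]
    near the base point a lives: the one over a if t >= 0, the one over the
    preimage of a if t < 0. Thus t * signed_height a t is the height in the
    tau-cover that corresponds to the height t in the unit cover. *)
Definition signed_height (a : X) (t : R) : R := if 0 <= t then tau a else tau (finv a).

Lemma to_unit_signed_height a t : -1 <= t <= 1 ->
  to_unit (cover a (t * signed_height a t)) = cover1 a t.
Proof.
move=> /andP[t0 t1]; rewrite /signed_height.
case: ifPn => [tp|]; last rewrite -ltNge => tn.
  rewrite to_unit_cover_point ?mulfK ?gt_eqF//.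
  by rewrite mulr_ge0 ?(ltW (tau_gt0 a))//= ler_piMl// ltW.
rewrite -(cover_pointV f tau_gt0 cptX ctau).
rewrite -(cover_pointV f (@unit_height_gt0 R X) cptX cone).
have h := tau_gt0 (finv a).
have -> : t * tau (finv a) + tau (finv a) = (t + 1) * tau (finv a) by lra.
rewrite to_unit_cover_point ?mulfK ?gt_eqF//.
by apply/andP; split; [apply: mulr_ge0|rewrite ler_piMl//]; lra.
Qed.

(** Passing from unit heights to tau-heights is Lipschitz up to the variation of
    tau; across the base, where the tower changes, the two sides add up. *)
Lemma signed_height_dist C a r b t : (forall x, tau x <= C) -> `|t| <= 1 ->
  `|r * signed_height a r - t * signed_height b t| <=
  C * `|r - t| + (`|tau a - tau b| + `|tau (finv a) - tau (finv b)|).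
Proof.
move=> tauC t1; rewrite /signed_height.
have [a0 b0 a1 b1] := And4 (tau_gt0 a) (tau_gt0 b) (tau_gt0 (finv a)) (tau_gt0 (finv b)).
have [aC bC aC1 bC1] := And4 (tauC a) (tauC b) (tauC (finv a)) (tauC (finv b)).
have n1 := normr_ge0 (tau a - tau b).
have n2 := normr_ge0 (tau (finv a) - tau (finv b)).
have same (u v : R) : 0 < u -> u <= C ->
    `|r * u - t * v| <= C * `|r - t| + `|u - v|.
  move=> u0 uC; have -> : r * u - t * v = u * (r - t) + t * (u - v) by lra.
  apply: le_trans (ler_normD _ _) _; rewrite !normrM (gtr0_norm u0).
  by rewrite lerD// ?ler_wpM2r// ler_piMl.
have opp (u v : R) : 0 < u -> u <= C -> 0 < v -> v <= C -> r * t <= 0 ->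
    `|r * u - t * v| <= C * `|r - t|.
  move=> u0 uC v0 vC rt.
  have [r0|r0] := leP 0 r.
    have [t0|t0] := leP t 0; first by rewrite !ger0_norm; nra.
    have -> : r = 0 by nra.
    by rewrite mul0r !sub0r !normrN !ger0_norm; nra.
  have t0 : 0 <= t by nra.
  by rewrite !ler0_norm; nra.
case: ifPn => [r0|]; case: ifPn => [t0|]; rewrite -?ltNge.
- by have := same _ (tau b) a0 aC; lra.
- by move=> t0; have := opp _ _ a0 aC b1 bC1 (mulr_ge0_le0 r0 (ltW t0)); lra.
- by move=> r0; have := opp _ _ a1 aC1 b0 bC (mulr_le0_ge0 (ltW r0) t0); lra.
- by move=> _ _; have := same _ (tau (finv b)) a1 aC1; lra.
Qed.

Lemma signed_height_dist_lower c a r b t : 0 < c -> (forall x, c <= tau x) ->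
  `|t| <= 1 ->
  c * `|r - t| <= `|r * signed_height a r - t * signed_height b t| +
    (`|tau a - tau b| + `|tau (finv a) - tau (finv b)|).
Proof.
move=> c0 tauc t1; rewrite /signed_height.
have [ac bc ac1 bc1] := And4 (tauc a) (tauc b) (tauc (finv a)) (tauc (finv b)).
have n1 := normr_ge0 (tau a - tau b).
have n2 := normr_ge0 (tau (finv a) - tau (finv b)).
have same (u v : R) : c <= u ->
    c * `|r - t| <= `|r * u - t * v| + `|u - v|.
  move=> cu; apply: (@le_trans _ _ (`|u * (r - t)|)).
    by rewrite normrM ler_wpM2r// ger0_norm//; lra.
  have -> : u * (r - t) = (r * u - t * v) - t * (u - v) by lra.
  apply: le_trans (ler_normB _ _) _; rewrite lerD2l normrM.
  by rewrite ler_piMl.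
have opp (u v : R) : c <= u -> c <= v -> (r <= 0 /\ 0 <= t \/ 0 <= r /\ t <= 0) ->
    c * `|r - t| <= `|r * u - t * v|.
  move=> cu cv [[r0 t0]|[r0 t0]].
    by rewrite !ler0_norm; nra.
  by rewrite !ger0_norm; nra.
case: ifPn => [r0|]; case: ifPn => [t0|]; rewrite -?ltNge.
- by have := same _ (tau b) ac; lra.
- by move=> t0; have := opp _ _ ac bc1 (or_intror (conj r0 (ltW t0))); lra.
- by move=> r0; have := opp _ _ ac1 bc (or_introl (conj (ltW r0) t0)); lra.
- by move=> _ _; have := same _ (tau (finv b)) ac1; lra.
Qed.

Lemma unif_continuous_height_finv e : 0 < e ->
  exists2 e', 0 < e' & forall x y, mdist x y <= e' ->
    `|tau x - tau y| + `|tau (finv x) - tau (finv y)| <= e.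
Proof.
move=> e0; have e20 : 0 < e / 2 by rewrite divr_gt0.
have [h1 h10 h1P] := unif_continuous_height cptX ctau e20.
have [h2 h20 h2P] := unif_continuous_mdist cptX (@homeo_inv_continuous _ f) h10.
exists (Num.min h1 h2) => [|x y]; first by rewrite lt_min h10.
by rewrite le_min => /andP[/h1P ? /h2P/h1P]; lra.
Qed.

(** Near the base, a small Bowen-Walters distance comes from a nearby lift: take
    an almost minimal path, lift it in the unit suspension, and rescale. *)
Lemma bw_dist_lift_center e : 0 < e -> exists2 h, 0 < h & forall p b t,
  `|t| <= 1 / 2 -> rho p (cover b (t * signed_height b t)) <= h ->
  exists a r, p = cover a r /\ near_lift e a r b (t * signed_height b t).
Proof.
move=> e0; have [C C0 tauC] := height_upper_bound.
have e20 : 0 < e / 2 by rewrite divr_gt0.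
have [h1 h10 h1P] := unif_continuous_height_finv e20.
have m0 : 0 < Num.min e h1 by rewrite lt_min e0.
have [h2 h20 h2P] := mdist_le_metric cptX dm dt m0.
pose L := Num.min (1 / 4) (Num.min (e / 2 / C) (h2 / 4)).
have [L0 L1 L2 L3] : [/\ 0 < L, L <= 1 / 4, L <= e / 2 / C & L <= h2 / 4].
  by rewrite /L !ge_min !lt_min !lexx !orbT ?divr_gt0.
exists (L / 2) => [|p b t t1 pb]; first by rewrite divr_gt0.
have tl := t1; rewrite ler_norml in tl; have {tl}/andP[tl tu] := tl.
have [l lL pl] : exists2 l, l < L &
    bw_path d (to_unit p) (to_unit (cover b (t * signed_height b t))) l.
  by apply: bw_dist1_lt => //; apply: le_lt_trans pb _; lra.
rewrite to_unit_signed_height in pl; last by apply/andP; split; lra.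
have [|a [r [pE rt dab]]] := bw_path_lift cptX dm pl (erefl _) lL; first lra.
have := rt; rewrite ler_norml => /andP[rl ru].
exists a, (r * signed_height a r); split.
  by apply: to_unit_inj; rewrite pE to_unit_signed_height//; apply/andP; split; lra.
have /andP[ab1 /h1P ab2] : (mdist a b <= e) && (mdist a b <= h1).
  by rewrite -le_min; apply: h2P; lra.
split=> //; apply: le_trans (signed_height_dist _ _ _ tauC _) _; first lra.
have : C * `|r - t| <= C * (e / 2 / C) by rewrite ler_wpM2l ?(ltW C0)//; lra.
by rewrite mulrCA divff ?gt_eqF// mulr1; lra.
Qed.

(** Near the base, nearby lifts are joined by a short vertical segment followed
    by a short horizontal one. *)
Lemma bw_dist_le_center e : 0 < e -> exists2 h, 0 < h & forall a r b t,
  `|t| <= 1 / 2 -> near_lift h a r b (t * signed_height b t) ->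
  rho (cover a r) (cover b (t * signed_height b t)) <= e.
Proof.
move=> e0; have [c c0 tauc] := height_lower_bound tau_gt0 cptX ctau.
have e40 : 0 < e / 4 by rewrite divr_gt0.
pose k := c * Num.min (1 / 4) (e / 8).
have k0 : 0 < k by rewrite mulr_gt0// lt_min !divr_gt0.
have [h1 h10 h1P] := unif_continuous_height_finv k0.
have [h2 h20 h2P] := metric_le_mdist cptX dm dt e40.
have [h3 h30 h3P] := unif_continuous_mdist cptX (@homeo_continuous _ f) h20.
have [h4 h40 h4P] := unif_continuous_mdist cptX (@homeo_inv_continuous _ f) h20.
exists (Num.min k (Num.min (Num.min h1 h2) (Num.min h3 h4))) => [|a r b t t1].
  by rewrite !lt_min k0 h10 h20 h30.
rewrite /near_lift !le_min -!andbA => -[/and5P[_ ab1 ab2 ab3 ab4] /andP[rk _]].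
have tl := t1; rewrite ler_norml in tl; have {tl}/andP[tl tu] := tl.
pose t' := r / signed_height a r.
have sh0 x y : 0 < signed_height x y by rewrite /signed_height; case: ifP.
have shE : signed_height a t' = signed_height a r.
  by rewrite /signed_height /t' (pmulr_lge0 _ (_ : 0 < (signed_height a r)^-1)) ?invr_gt0.
have rE : r = t' * signed_height a t' by rewrite shE divfK// gt_eqF.
have tt' : `|t' - t| <= 1 / 2 /\ `|t' - t| <= e / 4.
  have := signed_height_dist_lower a t' b c0 tauc (_ : `|t| <= 1).
  rewrite -rE => /(_ _)H; have {}H := H (ltac:(lra)); have := h1P _ _ ab1 => H1.
  have : `|t' - t| <= 2 * Num.min (1 / 4) (e / 8).
    rewrite -(ler_pM2l c0); apply: le_trans H _; rewrite mulrCA -/k; lra.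
  have := ge_min (1 / 4) (1 / 4) (e / 8); have := ge_min (e / 8) (1 / 4) (e / 8).
  by rewrite !lexx orbT; lra.
have := tt'.1; rewrite ler_norml => /andP[t'l t'u].
rewrite rE /bw_dist !to_unit_signed_height; [|apply/andP; split; lra..].
have [l lt' lP] := bw_path_vertical f d cptX a t' t.
suff [l' l'e l'P] : exists2 l', l' <= e / 2 &
    bw_path d (cover1 a t) (cover1 b t) l'.
  by apply: le_trans (bw_dist1_le dm (bw_path_cat lP l'P)) _; lra.
have d1 := h2P _ _ ab2; have d2 := h2P _ _ (h3P _ _ ab3).
have d3 := h2P _ _ (h4P _ _ ab4).
have [tp|tn] := leP 0 t.
  eexists; last by apply: bw_path_horizontal; apply/andP; split; lra.
  by nra.
rewrite -(cover_pointV f (@unit_height_gt0 R X) cptX cone a).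
rewrite -(cover_pointV f (@unit_height_gt0 R X) cptX cone b).
eexists; last by apply: bw_path_horizontal; apply/andP; split; lra.
by rewrite !homeoVK; nra.
Qed.

(** A point is described in the chart around the base below it when it lies in
    the lower half of its tower, and in the chart around the next base when it
    lies in the upper half. *)
Lemma lift_central b s : 0 <= s <= tau b ->
  (exists2 t, `|t| <= 1 / 2 & s = t * signed_height b t) \/
  (exists2 t, `|t| <= 1 / 2 & s - tau b = t * signed_height (f b) t).
Proof.
move=> /andP[s0 sb]; have b0 := tau_gt0 b.
have q0 : 0 <= s / tau b by rewrite divr_ge0// ltW.
have q1 : s / tau b <= 1 by rewrite ler_pdivrMr// mul1r.
have sE : s = s / tau b * tau b by rewrite divfK// gt_eqF.
have [t1|t1] := leP (s / tau b) (1 / 2).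
  by left; exists (s / tau b); rewrite ?ger0_norm// /signed_height q0.
right; exists (s / tau b - 1); first by rewrite ler0_norm; lra.
rewrite /signed_height; case: ifPn => [h|_]; last first.
  by rewrite homeoK mulrBl -sE mul1r.
have -> : s / tau b = 1 by lra.
by rewrite subrr mul0r; apply/eqP; rewrite subr_eq0 {1}sE; apply/eqP; nra.
Qed.

End local_product.

(** * The Bowen-Walters distance and the cover at bounded heights *)

Section local_product_global.
Context {R : realType} {X : metricType R} (f : homeomorphism X) (tau : X -> R).
Variables (tau_gt0 : forall x, 0 < tau x) (d : X -> X -> R).
Hypotheses (cptX : compact [set: X]) (ctau : continuous tau).
Hypotheses (dm : is_metric d) (dt : induces_topology d).

Local Notation Y := (suspension f tau).
Local Notation cover := (cover_point f tau_gt0).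
Local Notation rho := (@bw_dist R X d f tau).
Local Notation finv := (homeo_inv f).
Local Notation phi := (@suspension_flow R X f tau).

(** A property of lifts with uniform moduli, known near the base and stable
    under the deck shift by one return, holds uniformly on every bounded range
    of heights. Here e is the tolerance and h the radius; the shift may
    worsen both, which is harmless since a bounded height is brought near the
    base by a bounded number of shifts. *)
Lemma uniform_lift_ind (P : R -> R -> X -> R -> Prop) :
  (forall e h h' b s, h' <= h -> P e h b s -> P e h' b s) ->
  (forall e, 0 < e -> exists2 h, 0 < h & forall b t, `|t| <= 1 / 2 ->
     P e h b (t * signed_height f tau b t)) ->
  (forall e, 0 < e -> exists2 e', 0 < e' & forall h, 0 < h -> exists2 h', 0 < h' &
     forall b s, (P e' h b s -> P e h' (f b) (s - tau b)) /\
                 (P e' h b s -> P e h' (finv b) (s + tau (finv b)))) ->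
  forall L e, 0 < e -> exists2 h, 0 < h & forall b s, `|s| <= L -> P e h b s.
Proof.
move=> Pmono Pcentral Pshift L.
have [c c0 tauc] := height_lower_bound tau_gt0 cptX ctau.
suff H (k : nat) : forall e, 0 < e -> exists2 h, 0 < h &
    forall b s, - (k%:R * c) <= s <= tau b + k%:R * c -> P e h b s.
  move=> e e0; have [h h0 hP] := H (Num.bound (`|L| / c)) e e0.
  exists h => // b s sL; apply: hP.
  have : `|L| / c < (Num.bound (`|L| / c))%:R by rewrite archi_boundP// divr_ge0// ltW.
  rewrite ltr_pdivrMr// => LB; have := ler_norm L; have := tauc b.
  by move: sL; rewrite ler_norml => /andP[]; lra.
elim: k => [|k IH] e e0.
  have [e' e'0 eP] := Pshift e e0.
  have [h1 h10 h1P] := Pcentral e e0; have [h2 h20 h2P] := Pcentral e' e'0.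
  have [h3 h30 h3P] := eP h2 h20.
  exists (Num.min h1 h3) => [|b s]; first by rewrite lt_min h10.
  rewrite mul0r oppr0 addr0 => /(lift_central f tau_gt0)[[t t1 ->]|[t t1 tE]].
    by apply: Pmono (h1P _ _ t1); rewrite ge_min lexx.
  have := (h3P (f b) (s - tau b)).2; rewrite tE => /(_ (h2P _ _ t1)).
  by rewrite -tE homeoK subrK; apply: Pmono; rewrite ge_min lexx orbT.
have [e' e'0 eP] := Pshift e e0; have [h1 h10 h1P] := IH e e0.
have [h2 h20 h2P] := IH e' e'0; have [h3 h30 h3P] := eP h2 h20.
exists (Num.min h1 h3) => [|b s]; first by rewrite lt_min h10.
have k0 : 0 <= k%:R * c by rewrite mulr_ge0// ltW.
rewrite -addn1 natrD mulrDl mul1r => /andP[s1 s2].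
have le13 : Num.min h1 h3 <= h1 by rewrite ge_min lexx.
have le3 : Num.min h1 h3 <= h3 by rewrite ge_min lexx orbT.
have [s0|s0] := ltP s 0.
  have := tauc (finv b) => tc.
  have := (h3P (finv b) (s + tau (finv b))).1; rewrite homeoVK addrK => H.
  by apply: Pmono le3 (H _); apply: h2P; apply/andP; split; lra.
have [sb|sb] := leP s (tau b).
  by apply: Pmono le13 (h1P _ _ _); apply/andP; split; lra.
have := tauc (f b) => tc.
have := (h3P (f b) (s - tau b)).2; rewrite homeoK subrK => H.
by apply: Pmono le3 (H _); apply: h2P; apply/andP; split; lra.
Qed.

(** Bowen-Walters proximity to a point lifts to proximity to a prescribed lift of
    it. *)
Lemma bw_dist_lift L e : 0 < e -> exists2 h, 0 < h & forall b s, `|s| <= L ->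
  forall p, rho p (cover b s) <= h ->
  exists a r, p = cover a r /\ near_lift e a r b s.
Proof.
move: L e; apply: uniform_lift_ind => [e h h' b s hh' H p ph'|e e0|e e0].
- by apply: H; lra.
- have [h h0 hP] := bw_dist_lift_center f tau_gt0 cptX ctau dm dt e0.
  by exists h => // b t t1 p; exact: hP.
have [e' e'0 eP] := near_lift_shift f cptX ctau e0.
exists e' => // h h0; exists h => // b s; split=> H p.
  rewrite (cover_pointS f tau_gt0 cptX ctau) => /H[a [r [-> /eP[ar _]]]].
  by exists (f a), (r - tau a); rewrite (cover_pointS f tau_gt0 cptX ctau).
rewrite (cover_pointV f tau_gt0 cptX ctau) => /H[a [r [-> /eP[_ ar]]]].
by exists (finv a), (r + tau (finv a)); rewrite (cover_pointV f tau_gt0 cptX ctau).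
Qed.

(** The covering map is uniformly continuous on bounded heights. *)
Lemma bw_dist_le L e : 0 < e -> exists2 h, 0 < h & forall b s, `|s| <= L ->
  forall a r, near_lift h a r b s -> rho (cover a r) (cover b s) <= e.
Proof.
move: L e; apply: uniform_lift_ind => [e h h' b s hh' H a r [ab rs]|e e0|e e0].
- by apply: H; split; lra.
- have [h h0 hP] := bw_dist_le_center f tau_gt0 cptX ctau dm dt e0.
  by exists h => // b t t1 a r; exact: hP.
exists e => // h h0; have [h' h'0 hP] := near_lift_shift f cptX ctau h0.
exists h' => // b s; split=> H a r /hP[h1 h2].
  rewrite -(cover_pointV f tau_gt0 cptX ctau a) (cover_pointS f tau_gt0 cptX ctau b).
  by apply: H; rewrite homeoK subrK in h2.
rewrite -(cover_pointS f tau_gt0 cptX ctau a) (cover_pointV f tau_gt0 cptX ctau b).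
by apply: H; rewrite homeoVK addrK in h1.
Qed.

Lemma suspension_flow_unif_continuous T e : 0 < e ->
  exists2 h, 0 < h & forall p q, rho p q <= h ->
    forall v, 0 <= v <= T -> rho (phi v p) (phi v q) <= e.
Proof.
move=> e0; have [C C0 tauC] := height_upper_bound tau_gt0 cptX ctau.
have [h h0 hP] := bw_dist_le (C + T) e0.
have [h' h'0 h'P] := bw_dist_lift C h0.
exists h' => // p q pq v /andP[v0 vT].
have [b [s [/andP[s0 sb] qE]]] := cover_point_surj tau_gt0 q.
rewrite qE in pq *; have sC := tauC b.
have [|a [r [-> [ab rs]]]] := h'P b s _ p pq; first by rewrite ger0_norm; lra.
rewrite !(cover_point_flow f tau_gt0 cptX ctau); apply: hP.
  by rewrite ger0_norm; lra.
by split=> //; rewrite opprD addrACA subrr addr0.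
Qed.

End local_product_global.

(** * Pseudo-orbits of the flow over bounded times *)

Section polyline.
Context {R : realType} (w : int -> R) (c : R).
Hypotheses (c0 : 0 < c) (cw : forall k, c <= w k).

(** The piecewise affine map through the points (k, psumz w k). *)
Definition polyline (v : R) : R :=
  psumz w (Num.floor v) + (v - (Num.floor v)%:~R) * w (Num.floor v).

Lemma polyline_reparametrization : reparametrization polyline.
Proof.
have w0 k : 0 < w k by apply: lt_le_trans (cw k).
split=> [|u v uv|y].
- by rewrite /polyline floor0 psumz0 subr0 mul0r addr0.
- have := le_floor (ltW uv); rewrite le_eqVlt /polyline => /orP[/eqP->|lt_uv].
    by rewrite ltrD2l ltr_pM2r// ltrD2r.
  apply: (@lt_le_trans _ _ (psumz w (Num.floor u + 1))).
    rewrite psumzS ltrD2l gtr_pMl//.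
    by have := floorD1_gt u; rewrite intrD mulr1z; lra.
  apply: (@le_trans _ _ (psumz w (Num.floor v))).
    by apply: (psumz_le c0 cw); rewrite lezD1.
  by rewrite lerDl mulr_ge0 ?(ltW (w0 _))// subr_ge0 floor_le.
have [i /andP[i1 i2]] := psumz_cover c0 cw y.
rewrite psumzS in i2.
have z0 : 0 <= (y - psumz w i) / w i by rewrite divr_ge0 ?subr_ge0// ltW.
have z1 : (y - psumz w i) / w i < 1 by rewrite ltr_pdivrMr// mul1r; lra.
exists (i%:~R + (y - psumz w i) / w i).
have iE : Num.floor (i%:~R + (y - psumz w i) / w i) = i.
  by apply: floor_def; rewrite intrD mulr1z lerDl z0 ltrD2l.
by rewrite /polyline iE [_ + _ - _]addrAC subrr add0r divfK ?gt_eqF// addrC subrK.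
Qed.

End polyline.

Section shadowing_flow.
Context {R : realType} {X : metricType R} (f : homeomorphism X) (tau : X -> R).
Variables (tau_gt0 : forall x, 0 < tau x) (d : X -> X -> R).
Hypotheses (cptX : compact [set: X]) (ctau : continuous tau).
Hypotheses (dm : is_metric d) (dt : induces_topology d).

Local Notation Y := (suspension f tau).
Local Notation cover := (cover_point f tau_gt0).
Local Notation rho := (@bw_dist R X d f tau).
Local Notation phi := (@suspension_flow R X f tau).
Local Notation S := (birkhoff f tau).

Let flowE t x r : phi t (cover x r) = cover x (r + t).
Proof. exact: cover_point_flow. Qed.

Let flowD s t p : phi (s + t) p = phi s (phi t p).
Proof. exact: suspension_flowD. Qed.

Lemma bw_dist_xx (p : Y) : rho p p <= 0.
Proof. exact/(bw_dist1_le dm)/BWNil. Qed.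

(** Over a time window of length T a pseudo-orbit jumps at most T + 2 times, since
    its steps last at least 1, and each jump is propagated over a time at
    most T. The lengths of the steps themselves do not matter: along a long
    step the pseudo-orbit follows the flow exactly. *)
Lemma star_almost_orbit T e : 0 < e -> exists2 h, 0 < h & forall x t,
  flow_pseudo_orbit rho phi h 1 x t -> forall u v, 0 <= v <= T ->
  rho (phi v (star phi x t u)) (star phi x t (u + v)) <= e.
Proof.
move=> e0; pose N := (Num.bound `|T|).+1.
have TN : T + 1 < N%:R.
  by rewrite -natr1 ltrD2r; apply: le_lt_trans (ler_norm T) _; exact: archi_boundP.
have N0 : 0 < N%:R :> R by rewrite ltr0n.
have eN0 : 0 < e / N%:R by rewrite divr_gt0.
have [h h0 hP] := suspension_flow_unif_continuous f tau_gt0 cptX ctau dm dt T eN0.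
exists h => // x t po u v /andP[v0 vT].
have t1 i : 1 <= t i by have [] := po i.
have [i iP] := psumz_cover ltr01 t1 u; have [j jP] := psumz_cover ltr01 t1 (u + v).
rewrite (starE ltr01 t1 _ _ iP) (starE ltr01 t1 _ _ jP) -flowD.
move: iP jP => /andP[i1 i2] /andP[j1 j2].
have ij : i <= j.
  rewrite -ltzD1 ltNge; apply/negP => /(psumz_le ltr01 t1); lra.
have [n jE] : exists n : nat, j = i + n%:Z.
  by exists `|j - i|%N; rewrite gez0_abs ?subr_ge0// GRing.subrKC.
have nT : n%:R <= T + 1.
  case: n jE => [|n] jE; first by have := ltrn0 R 0; lra.
  have := psumz_nat_ge t1 (i + 1) n.
  have -> : i + 1 + n%:Z = j by rewrite jE -add1n PoszD addrA.
  by rewrite -natr1; lra.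
subst j; suff H (k : nat) : (k <= n)%N -> rho (phi (v + (u - psumz t i)) (x i))
    (phi (u + v - psumz t (i + k%:Z)) (x (i + k%:Z))) <= k%:R * (e / N%:R).
  apply: le_trans (H n (leqnn n)) _; rewrite mulrA ler_pdivrMr// mulrC.
  by rewrite ler_pM2l//; lra.
elim: k => [_|k IH kn].
  rewrite addr0 mul0r; have -> : v + (u - psumz t i) = u + v - psumz t i by lra.
  exact: bw_dist_xx.
pose mid := phi (u + v - psumz t (i + k%:Z)) (x (i + k%:Z)).
apply: le_trans (bw_dist_triangle cptX dm _ mid _) _; rewrite /mid.
rewrite -natr1 mulrDl mul1r lerD ?IH 1?ltnW//.
have -> : i + k.+1%:Z = i + k%:Z + 1 by rewrite -addn1 PoszD addrA.
rewrite psumzS.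
have -> : u + v - psumz t (i + k%:Z) =
  u + v - (psumz t (i + k%:Z) + t (i + k%:Z)) + t (i + k%:Z) by lra.
rewrite flowD; apply: hP; first by have [] := po (i + k%:Z).
rewrite -psumzS; apply/andP; split.
  have : psumz t (i + k%:Z + 1) <= psumz t (i + n%:Z).
    by apply: (psumz_le ltr01 t1); rewrite -addrA lerD2l lezD1 ltz_nat.
  by lra.
have : psumz t (i + 1) <= psumz t (i + k%:Z + 1).
  by apply: (psumz_le ltr01 t1); rewrite lerD2r lerDl.
by lra.
Qed.

(** Iterates and return times are simultaneously uniformly continuous, since both
    are read off from iterated deck shifts. *)
Lemma near_lift_iter (B : nat) e : 0 < e -> exists2 h, 0 < h &
  forall a b, mdist a b <= h -> forall m : nat, (m <= B)%N ->
  mdist (iter m f a) (iter m f b) <= e /\ `|S m%:Z a - S m%:Z b| <= e.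
Proof.
suff H : forall e, 0 < e -> exists2 h, 0 < h &
    forall a b, mdist a b <= h -> forall m : nat, (m <= B)%N ->
    near_lift e (iter m f a) (- S m%:Z a) (iter m f b) (- S m%:Z b).
  move=> /H[h h0 hP]; exists h => // a b /hP{}hP m /hP[ab Sab]; split=> //.
  by move: Sab; rewrite opprK addrC distrC.
elim: B => [|B IH] {}e e0.
  exists e => // a b ab m; rewrite leqn0 => /eqP->.
  by split=> //; rewrite !birkhoff0 subrr normr0 ltW.
have [e' e'0 eP] := near_lift_shift f cptX ctau e0.
have m0 : 0 < Num.min e e' by rewrite lt_min e0.
have [h h0 hP] := IH _ m0; exists h => // a b /hP ab m.
rewrite leq_eqVlt => /orP[/eqP->|]; last first.
  by rewrite ltnS => /ab; rewrite /near_lift !le_min => -[/andP[? _] /andP[]].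
have /eP[] : near_lift e' (iter B f a) (- S B%:Z a) (iter B f b) (- S B%:Z b).
  by have := ab B (leqnn B); rewrite /near_lift !le_min => -[/andP[_ ?] /andP[]].
have SE z : - S B.+1%:Z z = - S B%:Z z - tau (iter B f z).
  by rewrite -addn1 PoszD birkhoffS opprD.
by rewrite !SE.
Qed.

Lemma birkhoff_nat_ge c (m : nat) x : (forall x, c <= tau x) -> m%:R * c <= S m%:Z x.
Proof.
move=> tauc; have := psumz_nat_ge (fun i => tauc (iterz f i x)) 0 m.
by rewrite psumz0 !add0r.
Qed.

Lemma birkhoff_neg (m : int) x : m <= 0 -> S m x <= 0.
Proof.
have [c c0 tauc] := height_lower_bound tau_gt0 cptX ctau.
by move=> /(psumz_le c0 (fun i => tauc (iterz f i x))); rewrite psumz0.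
Qed.

End shadowing_flow.

(** * From shadowing for the homeomorphism to shadowing for the flow *)

Section shadowable_flow_points.
Context {R : realType} {X : metricType R} (f : homeomorphism X) (tau : X -> R).
Variables (tau_gt0 : forall x, 0 < tau x) (d : X -> X -> R).
Hypotheses (cptX : compact [set: X]) (ctau : continuous tau).
Hypotheses (dm : is_metric d) (dt : induces_topology d).

Local Notation cover := (cover_point f tau_gt0).
Local Notation rho := (@bw_dist R X d f tau).
Local Notation phi := (@suspension_flow R X f tau).
Local Notation S := (birkhoff f tau).

Let flowE t x r : phi t (cover x r) = cover x (r + t).
Proof. exact: cover_point_flow. Qed.

Lemma psumz_intr (m : int -> int) k :
  psumz (fun i => (m i)%:~R : R) k = (psumz m k)%:~R.
Proof.
elim/int_shift_ind: k => [|k]; first by rewrite !psumz0.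
by rewrite !psumzS intrD; split=> [->//|/addIr].
Qed.

(** Orbit segments of positive lengths m k, each ending close to the start of the
    next one, concatenate to a pseudo-orbit that has the same jumps. *)
Lemma concat_orbit_segments (a : int -> X) (m : int -> nat) e :
  (forall k, (0 < m k)%N) -> 0 < e ->
  (forall k, mdist (iter (m k) f (a k)) (a (k + 1)) <= e) ->
  exists xs : int -> X, pseudo_orbit f e xs /\
    forall k, xs (psumz (fun i => (m i)%:Z) k) = a k.
Proof.
move=> m0 e0 ae; pose M := psumz (fun i => (m i)%:Z).
pose mr k : R := (m k)%:Z%:~R.
have m1 k : 1 <= mr k by rewrite /mr -(mulr1z 1) ler_int; have := m0 k; lia.
have ME k : psumz mr k = (M k)%:~R by exact: psumz_intr.
pose xs (n : int) := star (fun r : R => iterz f (Num.floor r)) a mr n%:~R.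
have xsE k n : M k <= n < M (k + 1) -> xs n = iterz f (n - M k) (a k).
  move=> kn; have knR : psumz mr k <= n%:~R < psumz mr (k + 1).
    by rewrite !ME ler_int ltr_int.
  by rewrite /xs (starE ltr01 m1 _ _ knR) ME -intrB intrKfloor.
have MS k : M (k + 1) = M k + (m k)%:Z by exact: psumzS.
have xsM k : xs (M k) = a k.
  rewrite (xsE k) ?subrr// MS lexx/= ltrDl; have := m0 k; lia.
exists xs; split=> // n.
have [k] := psumz_cover ltr01 m1 n%:~R; rewrite !ME ler_int ltr_int => kn.
have /andP[k1 k2] := kn.
have [nk|nk] := ltP (n + 1) (M (k + 1)).
  rewrite (xsE _ _ kn) (xsE k (n + 1)); last by apply/andP; split=> //; lia.
  by rewrite addrAC iterzS mdistxx ltW.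
have nE : n + 1 = M (k + 1) by lia.
rewrite nE xsM (xsE _ _ kn) -iterzS.
have -> : n - M k + 1 = (m k)%:Z by move: nE; rewrite MS; lia.
exact: ae.
Qed.

(** Sample the pseudo-orbit at the multiples of a time T longer than a return.
    The base points of the samples generate a pseudo-orbit of f through x; if q
    shadows it, the flow orbit of q, made to pass at time k T the height of the
    k-th sample, shadows the samples, hence the whole pseudo-orbit. Only
    boundedly many returns occur between two samples, so the times at which the
    orbit of q passes those heights have increments close to T, and
    interpolating them affinely is accurate enough. *)
Lemma shadowable_flow_of_shadowable x s : shadowable_points f x ->
  0 <= s <= tau x -> flow_shadowable_points rho phi (cover x s).
Proof.
move=> shx sx e e0; have e20 : 0 < e / 2 by rewrite divr_gt0.
have [c c0 tauc] := height_lower_bound tau_gt0 cptX ctau.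
have [C C0 tauC] := height_upper_bound tau_gt0 cptX ctau.
(* T exceeds every height by 2, which leaves room for the errors. *)
pose T := C + 2; have T2 : T = C + 2 by [].
have [h1 h10 h1P] := bw_dist_le f tau_gt0 cptX ctau dm dt (C + T) e20.
pose kap := Num.min h1 1.
have [kap0 kap1 kaph] : [/\ 0 < kap, kap <= 1 & kap <= h1].
  by rewrite /kap lt_min h10 ltr01 !ge_min !lexx orbT.
have kap20 : 0 < kap / 2 by rewrite divr_gt0.
pose B := Num.bound ((C + T + 1) / c).
have BP : C + T + 1 < B%:R * c.
  by rewrite -ltr_pdivrMr// archi_boundP// divr_ge0 ?(ltW c0)//; lra.
have [h2 h20 h2P] := near_lift_iter f cptX ctau B kap20.
have h120 : 0 < Num.min h1 h2 by rewrite lt_min h10.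
have [df df0 dfP] := shx _ h120.
have m0 : 0 < Num.min df (kap / 2) by rewrite lt_min df0.
have [h3 h30 h3P] := bw_dist_lift f tau_gt0 cptX ctau dm dt C m0.
have m30 : 0 < Num.min h3 (e / 2) by rewrite lt_min h30.
have [h h0 hP] := star_almost_orbit f tau_gt0 cptX ctau dm dt T m30.
exists h => // xo t po xo0.
pose g := star phi xo t.
have gP u v : 0 <= v <= T -> rho (phi v (g u)) (g (u + v)) <= h3 /\
    rho (phi v (g u)) (g (u + v)) <= e / 2.
  by move=> vT; have := hP _ _ po u v vT; rewrite le_min => /andP[].
have t1 i : 1 <= t i by have [] := po i.
have g0 : g 0 = cover x s.
  have i0 : psumz t 0 <= 0 < psumz t (0 + 1).
    by rewrite psumzS psumz0 lexx add0r; have := t1 0; lra.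
  by rewrite /g (starE ltr01 t1 _ _ i0) psumz0 subrr xo0 (suspension_flow0 tau_gt0).
(* The first lift is based at x itself, not merely at a point of the same flow
   orbit, so that the pseudo-orbit of f below passes through x. *)
have ex_ar (k : int) : exists ar : X * R, [/\ g (k%:~R * T) = cover ar.1 ar.2,
    0 <= ar.2 <= tau ar.1 & k = 0 -> ar.1 = x].
  have [->|/eqP k0] := eqVneq k 0; first by exists (x, s); rewrite mul0r g0.
  have [a [r [r01 ->]]] := cover_point_surj tau_gt0 (g (k%:~R * T)).
  by exists (a, r).
have [ar arP] := choice ex_ar.
pose a k := (ar k).1; pose r k := (ar k).2.
have gE k : g (k%:~R * T) = cover (a k) (r k) by have [] := arP k.
have r01 k : 0 <= r k <= C.
  by have [_ /andP[r0 rt] _] := arP k; rewrite r0 (le_trans rt (tauC _)).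
have a0 : a 0 = x by have [_ _ H] := arP 0; exact: H.
(* The (k + 1)-st lift is a deck translate, by m k returns, of a lift close to
   the k-th one moved by T; m k is positive because T exceeds the heights. *)
have ex_m (k : int) : exists m : nat, [/\ (0 < m)%N, (m <= B)%N,
    mdist (iter m f (a k)) (a (k + 1)) <= df &
    `|r k + T - S m%:Z (a k) - r (k + 1)| <= kap / 2].
  have [|gk _] := gP (k%:~R * T) T; first by rewrite lexx andbT; lra.
  have kE : k%:~R * T + T = (k + 1)%:~R * T by rewrite intrD mulrDl mul1r.
  rewrite kE !gE flowE in gk.
  have [rk0 rkC] := andP (r01 k); have [rk10 rk1C] := andP (r01 (k + 1)).
  have [|b [t' [bE]]] := h3P (a (k + 1)) (r (k + 1)) _ _ gk; first by rewrite ger0_norm.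
  have [n [-> ->]] := cover_point_inj cptX ctau bE.
  rewrite /near_lift !le_min => -[/andP[b1 _] /andP[_ b2]].
  have b3 := b2; rewrite ler_norml in b3; case/andP: b3 => b3 b4.
  case: n b1 b2 b3 b4 {bE} => n b1 b2 b3 b4; last first.
    have : S (Negz n) (a k) <= 0 by exact: (birkhoff_neg f tau_gt0 cptX ctau).
    by lra.
  exists n; split=> //.
    by case: n b1 b2 b3 b4 => // b1 b2; rewrite birkhoff0; lra.
  rewrite -ltnS -(ltr_nat R); have := birkhoff_nat_ge f n (a k) tauc => nc.
  by rewrite -(ltr_pM2r c0) -natr1 mulrDl; lra.
have [m mP] := choice ex_m.
pose M := psumz (fun i => (m i)%:Z).
have MS k : M (k + 1) = M k + (m k)%:Z by exact: psumzS.
have [xs [xspo xsM]] : exists xs : int -> X, pseudo_orbit f df xs /\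
    forall k, xs (M k) = a k.
  by apply: concat_orbit_segments => // k; have [] := mP k.
have [|q qP] := dfP xs xspo; first by rewrite -a0 -(xsM 0) /M psumz0.
have qa k : mdist (iterz f (M k) q) (a k) <= Num.min h1 h2 by rewrite -xsM.
pose w k := S (m k)%:Z (iterz f (M k) q) + r (k + 1) - r k.
have wT k : `|w k - T| <= kap.
  have [_ mB _ mr] := mP k; have := qa k; rewrite le_min => /andP[_ q2].
  have [_ qS] := h2P _ _ q2 _ mB; rewrite /w.
  set A := S _ _ in qS *; set A' := S _ (a k) in qS mr.
  have -> : A + r (k + 1) - r k - T = (A - A') - (r k + T - A' - r (k + 1)) by lra.
  by apply: le_trans (ler_normB _ _) _; lra.
have w1 k : 1 <= w k by have := wT k; rewrite ler_norml => /andP[]; lra.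
(* The time at which the orbit of (q, r 0) is at height r k over f^(M k) q. *)
have orbE k : S (M k) q + r k = r 0 + psumz w k.
  elim/int_shift_ind: k => [|k]; first by rewrite /M !psumz0 birkhoff0 add0r addr0.
  rewrite MS [_ + (m k)%:Z]addrC birkhoffD psumzS /w; split; lra.
have T0 : 0 < T by lra.
have [p0 ph ps] := polyline_reparametrization ltr01 w1.
exists (cover q (r 0)), (fun u => polyline w (u / T)); split.
  split; first by rewrite mul0r p0.
    by move=> u v uv; apply: ph; rewrite ltr_pM2r// invr_gt0.
  by move=> v; have [u uE] := ps v; exists (u * T); rewrite mulfK ?gt_eqF.
move=> u; pose k := Num.floor (u / T); pose v := u - k%:~R * T.
have /andP[k1 k2] := floor_itv (u / T); rewrite -/k in k1 k2.
have vT : 0 <= v <= T.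
  have uE : u = u / T * T by rewrite divfK// gt_eqF.
  rewrite /v subr_ge0 lerBlDr {1 2}uE ler_pM2r// k1/=.
  rewrite intrD mulr1z in k2.
  have -> : T + k%:~R * T = (k%:~R + 1) * T by rewrite mulrDl mul1r addrC.
  by rewrite ler_pM2r// ltW.
have [_ gu] := gP (k%:~R * T) v vT.
rewrite gE flowE {2}/v [k%:~R * T + _]addrC subrK in gu.
have hE : polyline w (u / T) = psumz w k + v + v / T * (w k - T).
  rewrite /polyline -/k; have -> : u / T - k%:~R = v / T.
    by rewrite /v mulrBl mulfK ?gt_eqF.
  move: (w k) (psumz w k) => wk pk; rewrite mulrBr divfK ?gt_eqF//; lra.
rewrite flowE -(cover_point_shift f tau_gt0 cptX ctau (M k) q) hE.
apply: le_trans (bw_dist_triangle cptX dm _ (cover (a k) (r k + v)) _) _.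
rewrite (bw_dist_sym cptX dm) [leRHS]splitr lerD// (bw_dist_sym cptX dm).
have [rk0 rkC] := andP (r01 k); have [v0 vT'] := andP vT.
apply: h1P; first by rewrite ger0_norm; lra.
split; first by have := qa k; rewrite le_min => /andP[].
have -> : r 0 + (psumz w k + v + v / T * (w k - T)) - S (M k) q - (r k + v) =
    v / T * (w k - T) by have := orbE k; lra.
rewrite normrM; apply: le_trans kaph; apply: le_trans (wT k).
rewrite ler_piMl// ger0_norm ?divr_ge0//; last by rewrite ltW.
by rewrite ler_pdivrMr// mul1r.
Qed.

End shadowable_flow_points.

(** * Continuous functions close to discrete levels *)

Section continuous_levels.
Context {R : realType}.

(** A monotone function without gaps in its range has no jumps. *)
Lemma reparametrization_continuous (h : R -> R) :
  reparametrization h -> continuous h.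
Proof.
case=> _ hh hs u; apply/cvgrPdist_lt => e e0.
have [u1 u1E] := hs (h u - e / 2); have [u2 u2E] := hs (h u + e / 2).
have hle v w : v <= w -> h v <= h w.
  by rewrite le_eqVlt => /orP[/eqP->//|/hh/ltW].
have u1u : u1 < u by rewrite ltNge; apply/negP => /hle; lra.
have uu2 : u < u2 by rewrite ltNge; apply/negP => /hle; lra.
near=> v.
have h1 : h u1 < h v by apply: hh; near: v; exact: lt_nbhsr.
have h2 : h v < h u2 by apply: hh; near: v; exact: lt_nbhsl.
by rewrite ltr_norml; apply/andP; split; lra.
Unshelve. all: by end_near. Qed.

Variables (s : int -> R) (c : R).
Hypotheses (c0 : 0 < c) (sc : forall i j, i < j -> s i + c <= s j).

Lemma level_unique (g : R) i j : `|g - s i| <= c / 4 -> `|g - s j| <= c / 4 -> i = j.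
Proof.
rewrite !ler_norml => /andP[i1 i2] /andP[j1 j2].
suff : c <= 0 \/ i = j by case=> //; rewrite leNgt c0.
by case: (ltgtP i j) => [/sc ?|/sc ?|]; [left; lra|left; lra|right].
Qed.

(** A continuous function that stays near a uniformly discrete set of levels
    stays near one level, by the intermediate value theorem. *)
Lemma level_constant (G : R -> R) (a b : R) i : continuous G -> a <= b ->
  (forall u, a <= u <= b -> exists j, `|G u - s j| <= c / 4) ->
  `|G a - s i| <= c / 4 -> `|G b - s i| <= c / 4.
Proof.
move=> cG ab Gs Gai; have [|j Gbj] := Gs b; first by rewrite ab lexx.
suff ij : i = j by rewrite ij.
apply: contrapT => nij.
(* The midpoint of the gap above a level is far from all levels. *)
have gap (k l : int) : ~ `|s k + c / 2 - s l| <= c / 4.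
  rewrite ler_norml => /andP[l1 l2].
  suff : c <= 0 by rewrite leNgt c0.
  by case: (ltgtP k l) l1 l2 => [/sc ?|/sc ?|->] l1 l2; lra.
have cross (k : int) : Num.min (G a) (G b) <= s k + c / 2 <= Num.max (G a) (G b) -> False.
  move=> /(IVT ab (continuous_subspaceT cG))[u]; rewrite in_itv/= => /Gs[l + uE].
  by rewrite uE => /gap.
move: Gai Gbj; rewrite !ler_norml => /andP[a1 a2] /andP[b1 b2].
case: (ltgtP i j) => // /sc ijc.
  apply: (cross i); rewrite ge_min le_max.
  by apply/andP; split; apply/orP; [left|right]; lra.
apply: (cross j); rewrite ge_min le_max.
by apply/andP; split; apply/orP; [right|left]; lra.
Qed.

End continuous_levels.

(** * From shadowing for the flow to shadowing for the homeomorphism *)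

Section shadowable_of_flow.
Context {R : realType} {X : metricType R} (f : homeomorphism X) (tau : X -> R).
Variables (tau_gt0 : forall x, 0 < tau x) (d : X -> X -> R).
Hypotheses (cptX : compact [set: X]) (ctau : continuous tau).
Hypotheses (dm : is_metric d) (dt : induces_topology d).

Local Notation cover := (cover_point f tau_gt0).
Local Notation rho := (@bw_dist R X d f tau).
Local Notation phi := (@suspension_flow R X f tau).
Local Notation S := (birkhoff f tau).

Let flowE t x r : phi t (cover x r) = cover x (r + t).
Proof. exact: cover_point_flow. Qed.

(** Over a bounded number of steps, a fine pseudo-orbit follows the true orbits. *)
Lemma pseudo_orbit_track (N : nat) e : 0 < e -> exists2 h, 0 < h &
  forall xs : int -> X, pseudo_orbit f h xs -> forall n (j : nat), (j <= N)%N ->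
  mdist (iter j f (xs n)) (xs (n + j%:Z)) <= e.
Proof.
elim: N e => [|N IH] e e0.
  by exists e => // xs _ n j; rewrite leqn0 => /eqP->; rewrite addr0 mdistxx ltW.
have e20 : 0 < e / 2 by rewrite divr_gt0.
have [h1 h10 h1P] := unif_continuous_mdist cptX (@homeo_continuous _ f) e20.
have m0 : 0 < Num.min h1 e by rewrite lt_min h10.
have [h2 h20 h2P] := IH _ m0.
exists (Num.min h2 (e / 2)) => [|xs po n j]; first by rewrite lt_min h20.
have po2 : pseudo_orbit f h2 xs.
  by move=> i; have := po i; rewrite le_min => /andP[].
rewrite leq_eqVlt => /orP[/eqP->|]; last first.
  by rewrite ltnS => /(h2P _ po2 n); rewrite le_min => /andP[].
have := h2P _ po2 n N (leqnn N); rewrite le_min => /andP[/h1P H _].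
have := po (n + N%:Z); rewrite le_min => /andP[_ H2].
have -> : n + N.+1%:Z = n + N%:Z + 1 by lia.
have := metric_triangle (f (iter N f (xs n))) (f (xs (n + N%:Z)))
  (xs (n + N%:Z + 1)).
by rewrite /=; lra.
Qed.

Lemma birkhoff_gap c x : 0 < c -> (forall x, c <= tau x) ->
  forall i j : int, i < j -> S i x + c <= S j x.
Proof.
move=> c0 tauc i j ij; have [n ->] : exists n : nat, j = i + 1 + n%:Z.
  by exists `|(j - (i + 1))%R|%N; rewrite gez0_abs; lia.
apply: (@le_trans _ _ (S (i + 1) x)).
  by rewrite birkhoffS lerD2l.
by apply: (psumz_le c0 (fun i => tauc (iterz f i x))); lia.
Qed.

(** If a reparametrized orbit follows the orbit of (b, s) from time T0 to T1, the
    delay between the two, measured in the cover, is at each time close to some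
    return time S_m z. It is continuous, and distinct return times are at
    least c apart, so the same m serves during the whole interval. *)
Lemma locked_returns c e (h : R -> R) z r0 b s T0 T1 :
  0 < c -> (forall x, c <= tau x) -> e <= c / 4 -> reparametrization h -> T0 <= T1 ->
  (forall u, T0 <= u <= T1 -> exists a r,
    phi (h u) (cover z r0) = cover a r /\ near_lift e a r b (s + (u - T0))) ->
  exists m, mdist (iterz f m z) b <= e /\
    `|r0 + h T0 - s - S m z| <= e /\
    `|r0 + h T1 - (s + (T1 - T0)) - S m z| <= e.
Proof.
move=> c0 tauc ec hrep T01 H.
have gap := @birkhoff_gap c z c0 tauc.
have lev u : T0 <= u <= T1 -> exists m, mdist (iterz f m z) b <= e /\
    `|r0 + h u - (s + (u - T0)) - S m z| <= e.
  move=> /H[a [r []]]; rewrite flowE => /(cover_point_inj cptX ctau)[m [-> ->]] [h1 h2].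
  by exists m; split=> //; rewrite addrAC.
pose G u := r0 + h u - (s + (u - T0)).
have cG : continuous G.
  move=> u; apply: cvgB.
    by apply: cvgD; [exact: cvg_cst|exact: reparametrization_continuous].
  by apply: cvgD; [exact: cvg_cst|apply: cvgB; [exact: cvg_id|exact: cvg_cst]].
have [|m [m1 m2]] := lev T0; first by rewrite lexx.
have [|m' [_ m'2]] := lev T1; first by rewrite lexx andbT.
exists m; split=> //; split; first by move: m2; rewrite subrr addr0.
suff <- : m' = m by [].
apply: (level_unique c0 gap (le_trans m'2 ec)).
apply: (level_constant c0 gap cG T01 _ (le_trans m2 ec)) => u /lev[j [_ j2]].
by exists j; exact: le_trans ec.
Qed.

(** From a pseudo-orbit xs of f through x, take every N-th term and place it at
    the same fraction al of its tower as the given point of the flow; letting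
    each flow up to the fraction al of the N-th next tower gives a flow
    pseudo-orbit through that point. Each step lasts at least 1 if N is large.
    In an orbit that shadows it, the number of returns m k to be made
    before meeting the k-th point is locked along each step, so it grows by
    exactly N from one step to the next: the base orbit of m 0 then shadows the
    chosen terms, and by uniform continuity all terms of xs. *)
Lemma shadowable_of_shadowable_flow x s : 0 <= s <= tau x ->
  flow_shadowable_points rho phi (cover x s) -> shadowable_points f x.
Proof.
move=> sx shp e e0; have e20 : 0 < e / 2 by rewrite divr_gt0.
have [c c0 tauc] := height_lower_bound tau_gt0 cptX ctau.
have [C C0 tauC] := height_upper_bound tau_gt0 cptX ctau.
pose al := s / tau x.
have [al0 al1] : 0 <= al /\ al <= 1.
  by have /andP[s0 s1] := sx; rewrite /al divr_ge0 ?ler_pdivrMr ?mul1r// (le_trans s0).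
have sE : s = al * tau x by rewrite /al divfK// gt_eqF.
pose sg y := al * tau y.
have sgC y : 0 <= sg y <= C.
  rewrite /sg mulr_ge0 ?(ltW (tau_gt0 _))//=; apply: le_trans (tauC y).
  by rewrite ler_piMl// ltW.
pose N := Num.bound ((1 + C) / c).
have NP : 1 + C < N%:R * c.
  by rewrite -ltr_pdivrMr// archi_boundP// divr_ge0 ?(ltW c0)//; lra.
have N0 : (0 < N)%N.
  by rewrite lt0n; apply/eqP => N0; move: NP; rewrite N0 mul0r; lra.
have c80 : 0 < Num.min (c / 16) (e / 2) by rewrite lt_min !divr_gt0.
have [h1 h10 h1P] := near_lift_iter f cptX ctau N c80.
pose eta := Num.min h1 (c / 16).
have eta0 : 0 < eta by rewrite lt_min h10 divr_gt0.
have [h2 h20 h2P] := bw_dist_lift f tau_gt0 cptX ctau dm dt (C + (N%:R * C + C)) eta0.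
have h220 : 0 < h2 / 2 by rewrite divr_gt0.
have [h3 h30 h3P] := shp _ h220.
have h4e0 : 0 < Num.min h3 (h2 / 2) by rewrite lt_min h30.
have [h4 h40 h4P] := bw_dist_le f tau_gt0 cptX ctau dm dt C h4e0.
have h5e0 : 0 < Num.min h4 (c / 16) by rewrite lt_min h40 divr_gt0.
have [h5 h50 h5P] := unif_continuous_height cptX ctau h5e0.
have h6e0 : 0 < Num.min (Num.min h4 h5) (e / 2) by rewrite !lt_min h40 h50.
have [h6 h60 h6P] := pseudo_orbit_track N h6e0.
exists h6 => // xs po xs0.
pose b k := xs (k * N%:Z).
have bN k : xs (k * N%:Z + N%:Z) = b (k + 1) by rewrite /b mulrDl mul1r.
pose fb k := iter N f (b k).
have fbP k : mdist (fb k) (b (k + 1)) <= h4 /\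
    `|sg (fb k) - sg (b (k + 1))| <= Num.min h4 (c / 16).
  have := h6P _ po (k * N%:Z) N (leqnn N).
  rewrite bN !le_min -!andbA => /and3P[H4 /h5P H5 _]; split=> //.
  rewrite -le_min; apply: le_trans H5; rewrite /sg -mulrBr normrM (ger0_norm al0).
  by rewrite ler_piMl.
pose t k := S N%:Z (b k) + sg (fb k) - sg (b k).
have SN y : 1 + C < S N%:Z y by apply: lt_le_trans NP _; exact: birkhoff_nat_ge.
have SNC y : S N%:Z y <= N%:R * C.
  rewrite /birkhoff /= -[N in N%:R]card_ord mulr_natl -sumr_const.
  by apply: ler_sum => i _; exact: tauC.
have t1 k : 1 <= t k.
  have := SN (b k); have /andP[? ?] := sgC (fb k).
  by have /andP[? ?] := sgC (b k); rewrite /t; lra.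
pose P k := cover (b k) (sg (b k)).
have flowP k : phi (t k) (P k) = cover (fb k) (sg (fb k)).
  rewrite flowE -(cover_point_shift f tau_gt0 cptX ctau N%:Z (b k)) /t.
  by congr (cover _ _); lra.
have Pjump k : rho (phi (t k) (P k)) (P (k + 1)) <= Num.min h3 (h2 / 2).
  have [H1 H2] := fbP k; rewrite flowP; apply: h4P.
    by have /andP[? ?] := sgC (b (k + 1)); rewrite ger0_norm.
  by split=> //; move: H2; rewrite le_min => /andP[].
have poP : flow_pseudo_orbit rho phi h3 1 P t.
  by move=> k; split=> //; have := Pjump k; rewrite le_min => /andP[].
have P0 : P 0 = cover x s by rewrite /P /b mul0r xs0 /sg -sE.
have [y [h [hrep hP]]] := h3P P t poP P0.
have [z [r0 [_ yE]]] := cover_point_surj tau_gt0 y.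
have T01 k : psumz t k <= psumz t (k + 1) by rewrite psumzS lerDl; have := t1 k; lra.
(* The closed interval is covered too: at its right end the next point of the
   pseudo-orbit takes over, at the price of one jump. *)
have shd k u : psumz t k <= u <= psumz t (k + 1) ->
    rho (phi (h u) y) (cover (b k) (sg (b k) + (u - psumz t k))) <= h2.
  move=> /andP[u0 u1]; rewrite (bw_dist_sym cptX dm).
  have [uT|uT] := ltP u (psumz t (k + 1)).
    have kP : psumz t k <= u < psumz t (k + 1) by rewrite u0.
    by have := hP u; rewrite (starE ltr01 t1 _ _ kP) flowE; lra.
  have {uT u1}uE : u = psumz t (k + 1) by apply: le_anti; rewrite u1.
  have kP : psumz t (k + 1) <= u < psumz t (k + 1 + 1).
    by rewrite uE lexx [ltRHS]psumzS ltrDl; have := t1 (k + 1); lra.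
  have := hP u; rewrite (starE ltr01 t1 _ _ kP) uE subrr (suspension_flow0 tau_gt0) => H.
  have := Pjump k; rewrite le_min flowE => /andP[_ H2].
  apply: le_trans (bw_dist_triangle cptX dm _ (P (k + 1)) _) _.
  have -> : psumz t (k + 1) - psumz t k = t k by rewrite psumzS addrAC subrr add0r.
  by lra.
have etac : eta <= c / 4.
  by apply: (@le_trans _ _ (c / 16)); [rewrite /eta ge_min lexx orbT|lra].
have ex_m k : exists m, mdist (iterz f m z) (b k) <= eta /\
    `|r0 + h (psumz t k) - sg (b k) - S m z| <= eta /\
    `|r0 + h (psumz t (k + 1)) - (sg (b k) + t k) - S m z| <= eta.
  have tE : t k = psumz t (k + 1) - psumz t k by rewrite psumzS addrAC subrr add0r.
  rewrite tE; apply: (locked_returns c0 tauc etac hrep (T01 k)) => u uk.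
  rewrite -yE; apply: h2P; last exact: shd.
  have /andP[u0 u1] := uk; have /andP[s0 sC] := sgC (b k).
  have /andP[? ?] := sgC (fb k).
  have tk : t k <= N%:R * C + C by have := SNC (b k); rewrite /t; lra.
  by rewrite psumzS in u1; rewrite ger0_norm; lra.
have [m mP] := choice ex_m.
(* At the time where steps k and k + 1 meet, both m k + N and m (k + 1) count
   the returns made by the shadowing orbit, up to errors below the gap c; the
   bounds by c / 16 on the three errors make the total at most c / 4. *)
have mS k : m (k + 1) = m k + N%:Z.
  have [ak [_ ak1]] := mP k; have [_ [ak2 _]] := mP (k + 1).
  apply: (level_unique c0 (@birkhoff_gap c z c0 tauc) (le_trans ak2 etac)).
  have eta1 : eta <= h1 by rewrite /eta ge_min lexx.
  have eta8 : eta <= c / 16 by rewrite /eta ge_min lexx orbT.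
  have [_] := h1P _ _ (le_trans ak eta1) _ (leqnn N).
  rewrite le_min => /andP[SS _]; have [_] := fbP k; rewrite le_min => /andP[_ ss].
  rewrite [m k + _]addrC birkhoffD; move: ak1 SS ss; rewrite /t.
  rewrite !ler_norml => /andP[? ?] /andP[? ?] /andP[? ?]; apply/andP; split; lra.
have mE k : m k = m 0 + k * N%:Z.
  elim/int_shift_ind: k => [|k]; first by rewrite mul0r addr0.
  by rewrite mS mulrDl mul1r addrA; split=> [->//|/addIr].
exists (iterz f (m 0) z) => n.
have NZ : N%:Z != 0 by rewrite eqz_nat -lt0n.
have nE := divz_eq n N%:Z.
have : 0 <= (n %% N%:Z)%Z by exact: modz_ge0.
have : (n %% N%:Z)%Z < N%:Z by apply: ltz_pmod; rewrite ltz_nat.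
case: (n %% N%:Z)%Z nE => // j nE jN _.
rewrite -iterzD.
move: nE; set k := (n %/ N%:Z)%Z => nE.
have -> : n + m 0 = j%:Z + m k.
  by rewrite (mE k) nE addrAC [RHS]addrC; congr (_ + _); exact: addrC.
rewrite iterzD nE.
have jN' : (j <= N)%N by rewrite ltnW.
have [ak _] := mP k.
have [|] := h1P _ _ (le_trans ak _) _ jN'; first by rewrite /eta ge_min lexx.
rewrite le_min => /andP[_ H1] _.
have := h6P _ po (k * N%:Z) _ jN'; rewrite !le_min => /andP[_ H2].
have := metric_triangle (iterz f j (iterz f (m k) z)) (iter j f (b k))
  (xs (k * N%:Z + j)).
by rewrite /= /b in H1 *; lra.
Qed.

End shadowable_of_flow.

(** * Shadowable points of the suspension flow *)

Theorem theorem2p7 (R : realType) (X : metricType R) (f : homeomorphism X)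
    (tau : X -> R) (tau_gt0 : forall x : X, 0 < tau x) (d : X -> X -> R) :
  compact [set: X] -> continuous tau -> normalized_metric d ->
  let Sh_flow := flow_shadowable_points (@bw_dist R X d f tau)
                   (@suspension_flow R X f tau) in
  Sh_flow = [set susp_class f u | u in
              [set u : presuspension tau | shadowable_points f (val u).1]] /\
  Sh_flow = [set from_unit tau_gt0 p | p in
              [set susp_class f u | u in
                [set u : presuspension (fun=> 1 : R) |
                  shadowable_points f (val u).1]]].
Proof.
move=> cptX ctau [dm dt _] Sh_flow.
have Sh_flowE : Sh_flow = [set susp_class f u | u in
    [set u : presuspension tau | shadowable_points f (val u).1]].
  apply/seteqP; split=> [p shp|_ [u shu <-]]; last first.
    rewrite (cover_point_class f tau_gt0).
    exact: (shadowable_flow_of_shadowable tau_gt0 cptX ctau dm dt shu (valP u)).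
  exists (repr p); last exact: susp_class_repr.
  apply: (shadowable_of_shadowable_flow cptX ctau dm dt (valP (repr p))).
  by rewrite -(cover_point_class f tau_gt0) susp_class_repr.
split=> //; rewrite Sh_flowE.
apply/seteqP; split=> [_ [u shu <-]|_ [_ [u shu <-] <-]].
  exists (susp_class f (pre_to_unit u)); first by exists (pre_to_unit u).
  by rewrite -to_unitE// to_unitK.
by exists (pre_from_unit tau_gt0 u) => //; rewrite from_unitE.
Qed.
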